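(* Let $m>0$ and let $R\in(0,\sqrt{A_0}]$. Consider the solution $Q_i(s,R),P_i(s,R)$ of the regularized Hamiltonian system of $\Gamma$ with initial conditions $Q_1(0)=R$, $Q_2(0)=0$, $P_1(0)=0$, $P_2(0)=2m^{3/2}$, and let $s_1$ be the time when the first simultaneous binary collision happens. If $R$ satisfies $P_2(s_1,R)=0$, then the orbit is a one-dimensional Schubart-like periodic orbit, i.e. $(Q_1,Q_2,P_1,P_2)$ is periodic in $s$ and the motion regularly alternates between binary collisions of the inner two bodies and simultaneous binary collisions of the two clusters on both sides of the origin.
   Context: Regularized system. Let $$\Gamma=\frac{1}{16}Q_2^2P_1^2+\frac{Q_2^2P_1^2-4Q_1Q_2P_1P_2+4Q_1^2P_2^2}{16m}-m^2Q_1^2-2mQ_2^2-\frac{2mQ_1^2Q_2^2}{Q_1^2+Q_2^2}-\frac{Q_1^2Q_2^2}{2Q_1^2+Q_2^2}-Q_1^2Q_2^2E,\qquad E=-1,$$ with Hamilton's equations $Q_i'=\partial\Gamma/\partial P_i$, $P_i'=-\partial\Gamma/\partial Q_i$ ($i=1,2$), $'=d/ds$. The solution with initial data $Q_1(0)=R$, $Q_2(0)=0$, $P_1(0)=0$, $P_2(0)=2m^{3/2}$ (which lies on $\Gamma=0$) is denoted $Q_i(s,R),P_i(s,R)$. A binary collision (BC) of the inner two bodies means $Q_2=0$, $Q_1\neq0$. A simultaneous binary collision (SBC) means $Q_1=0$, $Q_2\neq0$. The time $s_1=s_1(R)>0$ is the first time an SBC happens. In this setting $Q_2>0$ for $0<s\le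 s_1$. Physical meaning: four collinear bodies, numbered 1 to 4 from right to left, of masses $1,m,m,1$ at positions $x_1,x_2,-x_2,-x_1$ ($x_1\ge x_2\ge0$), with total energy $-1$. Here $Q_1^2=x_1-x_2$, $Q_2^2=2x_2$, $P_1=4Q_1\dot x_1$, $P_2=2Q_2(\dot x_1+m\dot x_2)$, and physical time $t$ satisfies $dt/ds=Q_1^2Q_2^2$, $t(0)=0$. At a BC bodies 2 and 3 collide; at an SBC bodies 1 and 2 collide and simultaneously bodies 3 and 4 collide. The motion starts at a BC with $x_1(0)=A=R^2$, $x_2(0)=0$, $\dot x_1(0)=0$. Constant $A_0$: $A_0>0$ is the constant such that, with $t_1$ the physical time of the first SBC, the second body (position $x_2$) has no turning point for $t\in(0,t_1]$ whenever $0<A\le A_0$, and has at least one turning point for $t\in(0,t_1]$ if $A>A_0$. (A turning point of a body occurs at a time $t^*$ when its velocity $v$ vanishes and there are $t_a<t^*<t_b$ such that $v$ has one strict sign on $[t_a,t^* )$ and the opposite strict sign on $(t^*,t_b]$.) *)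

(* Defs.v *)
From Stdlib Require Import Reals ZArith.
From Coquelicot Require Import Coquelicot.
Open Scope R_scope.

(** Four collinear bodies of masses 1, m, m, 1 at x1, x2, -x2, -x1 with
    x1 >= x2 >= 0 and energy E, in the regularized variables
      Q1^2 = x1 - x2,  Q2^2 = 2 x2,  P1 = 4 Q1 x1',  P2 = 2 Q2 (x1' + m x2'),
    with fictitious time s related to physical time t by dt/ds = Q1^2 Q2^2. *)
Definition Gamma (m E q1 q2 p1 p2 : R) : R :=
  / 16 * q2 ^ 2 * p1 ^ 2
  + (q2 ^ 2 * p1 ^ 2 - 4 * q1 * q2 * p1 * p2 + 4 * q1 ^ 2 * p2 ^ 2) / (16 * m)
  - m ^ 2 * q1 ^ 2
  - 2 * m * q2 ^ 2
  - 2 * m * q1 ^ 2 * q2 ^ 2 / (q1 ^ 2 + q2 ^ 2)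
  - q1 ^ 2 * q2 ^ 2 / (2 * q1 ^ 2 + q2 ^ 2)
  - q1 ^ 2 * q2 ^ 2 * E.

Definition energy : R := -1.

Definition in_interval (a b : Rbar) (s : R) : Prop := Rbar_lt a s /\ Rbar_lt s b.

(** The total collapse q1 = q2 = 0, where Gamma is singular (and Rocq's
    division would return a meaningless value), is not in the phase space. *)
Definition in_phase_space (q1 q2 : R) : Prop := ~ (q1 = 0 /\ q2 = 0).

Definition hamilton_solution (m : R) (a b : Rbar) (Q1 Q2 P1 P2 : R -> R) : Prop :=
  forall s : R, in_interval a b s ->
    in_phase_space (Q1 s) (Q2 s) /\
    is_derive Q1 s
      (Derive (fun p => Gamma m energy (Q1 s) (Q2 s) p (P2 s)) (P1 s)) /\
    is_derive Q2 s
      (Derive (fun p => Gamma m energy (Q1 s) (Q2 s) (P1 s) p) (P2 s)) /\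
    is_derive P1 s
      (- Derive (fun q => Gamma m energy q (Q2 s) (P1 s) (P2 s)) (Q1 s)) /\
    is_derive P2 s
      (- Derive (fun q => Gamma m energy (Q1 s) q (P1 s) (P2 s)) (Q2 s)).

(** The orbit starting at an inner binary collision with outer bodies at rest
    at distance A = R0^2 from the origin, on its maximal interval of existence
    (a, b).  The values of the four functions outside (a, b) are irrelevant. *)
Definition orbit (m R0 : R) (a b : Rbar) (Q1 Q2 P1 P2 : R -> R) : Prop :=
  in_interval a b 0 /\
  hamilton_solution m a b Q1 Q2 P1 P2 /\
  Q1 0 = R0 /\ Q2 0 = 0 /\ P1 0 = 0 /\ P2 0 = 2 * (m * sqrt m) /\
  (forall (a' b' : Rbar) (Q1' Q2' P1' P2' : R -> R),
     Rbar_le a' a -> Rbar_le b b' ->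
     hamilton_solution m a' b' Q1' Q2' P1' P2' ->
     (forall s : R, in_interval a b s ->
        Q1' s = Q1 s /\ Q2' s = Q2 s /\ P1' s = P1 s /\ P2' s = P2 s) ->
     a' = a /\ b' = b).

(** BC: bodies 2 and 3 collide.  SBC: bodies 1 and 2 collide, and so do 3 and 4. *)
Definition BC (Q1 Q2 : R -> R) (s : R) : Prop := Q2 s = 0 /\ Q1 s <> 0.
Definition SBC (Q1 Q2 : R -> R) (s : R) : Prop := Q1 s = 0 /\ Q2 s <> 0.

Definition first_SBC (a b : Rbar) (Q1 Q2 : R -> R) (s1 : R) : Prop :=
  0 < s1 /\ in_interval a b s1 /\ SBC Q1 Q2 s1 /\
  (forall s : R, 0 < s < s1 -> ~ SBC Q1 Q2 s).

Definition phys_time (Q1 Q2 : R -> R) (s : R) : R :=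
  RInt (fun u => Q1 u ^ 2 * Q2 u ^ 2) 0 s.

(** [x] is the position of the second body as a function of physical time. *)
Definition second_body_position (a b : Rbar) (Q1 Q2 x : R -> R) : Prop :=
  forall s : R, in_interval a b s -> x (phys_time Q1 Q2 s) = Q2 s ^ 2 / 2.

Definition positive_velocity (x : R -> R) (t : R) : Prop :=
  exists v : R, is_derive x t v /\ 0 < v.
Definition negative_velocity (x : R -> R) (t : R) : Prop :=
  exists v : R, is_derive x t v /\ v < 0.

Definition turning_point (x : R -> R) (t : R) : Prop :=
  is_derive x t 0 /\
  exists ta tb : R, ta < t < tb /\
    (((forall u : R, ta <= u < t -> positive_velocity x u) /\
      (forall u : R, t < u <= tb -> negative_velocity x u)) \/
     ((forall u : R, ta <= u < t -> negative_velocity x u) /\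
      (forall u : R, t < u <= tb -> positive_velocity x u))).

(** [A0] is the threshold on the initial outer position A for the second body
    to turn no later than the first simultaneous binary collision. *)
Definition turning_threshold (m A0 : R) : Prop :=
  0 < A0 /\
  forall (A : R) (a b : Rbar) (Q1 Q2 P1 P2 : R -> R) (s1 : R) (x : R -> R),
    0 < A ->
    orbit m (sqrt A) a b Q1 Q2 P1 P2 ->
    first_SBC a b Q1 Q2 s1 ->
    second_body_position a b Q1 Q2 x ->
    (A <= A0 ->
       ~ exists t : R, 0 < t <= phys_time Q1 Q2 s1 /\ turning_point x t) /\
    (A0 < A ->
       exists t : R, 0 < t <= phys_time Q1 Q2 s1 /\ turning_point x t).

Definition periodic_orbit (Q1 Q2 P1 P2 : R -> R) : Prop :=
  exists T : R, 0 < T /\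
    forall s : R, Q1 (s + T) = Q1 s /\ Q2 (s + T) = Q2 s /\
                  P1 (s + T) = P1 s /\ P2 (s + T) = P2 s.

(** The collisions are equally spaced in s, and alternately BC and SBC. *)
Definition regularly_alternating (Q1 Q2 : R -> R) : Prop :=
  exists s0 d : R, 0 < d /\
    forall s : R,
      (BC Q1 Q2 s <-> exists k : Z, s = s0 + IZR (2 * k) * d) /\
      (SBC Q1 Q2 s <-> exists k : Z, s = s0 + IZR (2 * k + 1) * d).

Definition schubart_like (a b : Rbar) (Q1 Q2 P1 P2 : R -> R) : Prop :=
  a = m_infty /\ b = p_infty /\
  periodic_orbit Q1 Q2 P1 P2 /\ regularly_alternating Q1 Q2.

(* Main.v *)
Require Import Defs.
From Stdlib Require Import Reals ZArith.
From Coquelicot Require Import Coquelicot.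
From Stdlib Require Import Ranalysis5 Lra Classical ClassicalEpsilon.
Open Scope R_scope.

(** The flow commutes with two time reversals, (Q1, -Q2, -P1, P2)(-s), which
    fixes the initial binary collision, and (-Q1, Q2, P1, -P2)(2 s1 - s), which
    fixes the state at s1 because Q1 = P2 = 0 there.  By uniqueness the orbit
    coincides with both images; the reflected pieces would extend a maximal
    interval with a finite end, so the orbit is global, and the composition of
    the two reversals shows that it is antiperiodic with antiperiod 2 s1.

    It remains to see that Q2 > 0 on (0, s1].  Otherwise the second body returns
    to the origin before s1, so its velocity changes from positive to negative.
    Where this first happens the force on it must be negative, because at a zero
    of the velocity the force is increasing (the outer body moves inwards): this
    is a turning point, excluded by A <= A0. *)

(** * Real analysis *)

Lemma is_derive_continuity_pt (f : R -> R) (x l : R) :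
  is_derive f x l -> continuity_pt f x.
Proof.
intros H; apply derivable_continuous_pt; exists l; now apply is_derive_Reals.
Qed.

(** The eta-expanded form is the one in which [auto_derive] leaves the derivative of an unknown
    function, so this version can be used for rewriting. *)
Lemma Derive_eta (f : R -> R) (x l : R) :
  is_derive f x l -> Derive (fun y : R => f y) x = l.
Proof. exact (is_derive_unique f x l). Qed.

Lemma MVT_is_derive (f df : R -> R) (a b : R) :
  a < b -> (forall x, a <= x <= b -> is_derive f x (df x)) ->
  exists c, f b - f a = df c * (b - a) /\ a < c < b.
Proof.
intros hab hf.
apply MVT_cor2; [exact hab|].
intros c hc; apply is_derive_Reals, hf, hc.
Qed.

Lemma is_derive_pos_sign (f : R -> R) (x l : R) :
  is_derive f x l -> 0 < l ->
  exists h, 0 < h /\ (forall y, x < y < x + h -> f x < f y) /\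
            (forall y, x - h < y < x -> f y < f x).
Proof.
intros hf hl.
apply is_derive_Reals in hf.
destruct (hf (l / 2) ltac:(lra)) as [[h hh] H]; simpl in H.
exists h; split; [exact hh|split]; intros y hy.
- specialize (H (y - x) ltac:(lra) ltac:(rewrite Rabs_pos_eq; lra)).
  replace (x + (y - x)) with y in H by ring.
  apply Rabs_def2 in H.
  assert (e : f y - f x = (f y - f x) / (y - x) * (y - x)) by (field; lra).
  nra.
- specialize (H (y - x) ltac:(lra) ltac:(rewrite Rabs_left; lra)).
  replace (x + (y - x)) with y in H by ring.
  apply Rabs_def2 in H.
  assert (e : f y - f x = (f y - f x) / (y - x) * (y - x)) by (field; lra).
  nra.
Qed.

Lemma continuity_pt_pos (f : R -> R) (x : R) :
  continuity_pt f x -> 0 < f x ->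
  exists h, 0 < h /\ forall y, Rabs (y - x) < h -> 0 < f y.
Proof.
intros hc hx.
destruct (proj1 (continuity_pt_locally f x) hc (mkposreal _ hx)) as [[h hh] H]; simpl in H.
exists h; split; [exact hh|].
intros y hy.
specialize (H y hy).
apply Rabs_def2 in H; lra.
Qed.

Lemma IVT_le (f : R -> R) (a b y : R) :
  a <= b -> (forall x, a <= x <= b -> continuity_pt f x) ->
  f a <= y <= f b -> exists x, a <= x <= b /\ f x = y.
Proof.
intros hab hc [[h1|h1] [h2|h2]].
2, 4: now exists b; lra.
2: now exists a; lra.
assert (hne : a <> b) by (intros ->; lra).
destruct (IVT_interv (fun x => f x - y) a b) as [x [hx e]]; try lra.
- intros x hx; apply continuity_pt_minus; [now apply hc|].
  now apply continuity_pt_const; intros ? ?.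
- exists x; lra.
Qed.

(** [t] is the supremum of the points up to which [P] holds throughout. As [P] is arbitrary, [P t]
    itself stays open; failures occur at [t] or arbitrarily close to its right. *)
Lemma first_exit (P : R -> Prop) (a z : R) :
  a <= z -> P a -> ~ P z ->
  exists t, a <= t <= z /\ (forall y, a <= y < t -> P y) /\
            forall h, 0 < h -> exists s, t <= s < t + h /\ s <= z /\ ~ P s.
Proof.
intros haz ha hz.
set (E := fun x => x <= z /\ forall y, a <= y <= x -> P y).
assert (hE : E a) by (split; [exact haz|intros y hy; replace y with a by lra; exact ha]).
destruct (completeness E) as [t [hub hleast]].
- exists z; intros x [hx _]; exact hx.
- now exists a.
- assert (hat : a <= t) by now apply hub.
  assert (htz : t <= z) by (apply hleast; intros x [hx _]; exact hx).
  exists t; split; [lra|].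
  assert (hP : forall y, a <= y < t -> P y).
  { intros y hy.
    apply NNPP; intros hn.
    enough (t <= y) by lra.
    apply hleast; intros x [_ hx].
    destruct (Rle_lt_dec x y) as [h|h]; [exact h|].
    exfalso; apply hn, hx; lra. }
  split; [exact hP|].
  intros h hh.
  apply NNPP; intros hn.
  assert (hPs : forall s, t <= s < t + h -> s <= z -> P s).
  { intros s h1 h2; apply NNPP; intros h3; apply hn; now exists s. }
  set (x := Rmin z (t + h / 2)).
  assert (hx1 : x <= z) by apply Rmin_l.
  assert (hx2 : x <= t + h / 2) by apply Rmin_r.
  assert (hEx : E x).
  { split; [exact hx1|].
    intros y hy.
    destruct (Rlt_le_dec y t); [apply hP; lra|apply hPs; lra]. }
  assert (hxt : x <= t) by now apply hub.
  assert (x = z).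
  { unfold x in *; apply Rmin_left.
    destruct (Rle_lt_dec z (t + h / 2)) as [q|q]; [exact q|].
    rewrite Rmin_right in hxt; lra. }
  apply hz, hPs; lra.
Qed.

(** [D * exp (K * x)] does not decrease and [D * exp (- (K * x))] does not increase. The first
    bounds the nonnegative [D] by 0 to the left of [s0], the second to the right. *)
Lemma gronwall_zero (D dD : R -> R) (K al be s0 : R) :
  al <= s0 <= be ->
  (forall s, al <= s <= be -> is_derive D s (dD s)) ->
  (forall s, al <= s <= be -> 0 <= D s /\ Rabs (dD s) <= K * D s) ->
  D s0 = 0 -> forall s, al <= s <= be -> D s = 0.
Proof.
intros h0 hd hK h00 s hs.
destruct (hK s hs) as [hpos _].
assert (hE : forall x, 0 < exp x) by exact exp_pos.
destruct (Rtotal_order s s0) as [h|[->|h]]; [|exact h00|].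
- destruct (MVT_is_derive (fun x => D x * exp (K * x))
    (fun x => (dD x + K * D x) * exp (K * x)) s s0 h) as [c [e hc]].
  + intros x hx.
    assert (H := hd x ltac:(lra)).
    auto_derive.
    * now exists (dD x).
    * rewrite (Derive_eta _ _ _ H); ring.
  + destruct (hK c ltac:(lra)) as [_ hc'].
    apply Rabs_le_between in hc'.
    rewrite h00 in e.
    assert (0 <= (dD c + K * D c) * exp (K * c) * (s0 - s)).
    { repeat apply Rmult_le_pos; try lra; now apply Rlt_le. }
    specialize (hE (K * s)); nra.
- destruct (MVT_is_derive (fun x => D x * exp (- (K * x)))
    (fun x => (dD x - K * D x) * exp (- (K * x))) s0 s h) as [c [e hc]].
  + intros x hx.
    assert (H := hd x ltac:(lra)).
    auto_derive.
    * now exists (dD x).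
    * rewrite (Derive_eta _ _ _ H); ring.
  + destruct (hK c ltac:(lra)) as [_ hc'].
    apply Rabs_le_between in hc'.
    rewrite h00 in e.
    assert (0 <= (K * D c - dD c) * exp (- (K * c)) * (s - s0)).
    { repeat apply Rmult_le_pos; try lra; now apply Rlt_le. }
    specialize (hE (- (K * s))); nra.
Qed.

(** [x] is known only along the parametrization [T]. By the intermediate value theorem every point
    near [T s0] has the form [T (s0 + k)], and monotonicity of [T] forces [k] to be small, so
    difference quotients of [x] are ratios of those of [g] and [T]. *)
Lemma is_derive_param (x T g : R -> R) (al be s0 c d : R) :
  al < s0 < be ->
  (forall s, al <= s <= be -> continuity_pt T s) ->
  (forall s s', al <= s <= be -> al <= s' <= be -> s < s' -> T s < T s') ->
  (forall s, al <= s <= be -> x (T s) = g s) ->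
  0 < c -> is_derive T s0 c -> is_derive g s0 d ->
  is_derive x (T s0) (d / c).
Proof.
intros h0 hTc hTi hx hc hT hg.
apply is_derive_Reals; apply is_derive_Reals in hT; apply is_derive_Reals in hg.
intros eps heps.
set (M := 1 + Rabs (d / c)).
assert (hM : 0 < M) by (unfold M; generalize (Rabs_pos (d / c)); lra).
(* The bound [c / 2] keeps the difference quotient of [T] above [c / 2]; the other makes the
   numerator of the error at most [eps * c / 4]. *)
set (e1 := Rmin (c / 2) (eps * c / (4 * M))).
assert (he1 : 0 < e1).
{ apply Rmin_pos; [lra|].
  apply Rdiv_lt_0_compat; [nra|lra]. }
destruct (hT e1 he1) as [[h1 hh1] H1]; simpl in H1.
destruct (hg e1 he1) as [[h2 hh2] H2]; simpl in H2.
set (h := Rmin (Rmin (h1 / 2) (h2 / 2)) (Rmin (s0 - al) (be - s0))).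
assert (hh : 0 < h) by (repeat apply Rmin_pos; lra).
assert (hb1 : h <= h1 / 2) by (eapply Rle_trans; [apply Rmin_l|apply Rmin_l]).
assert (hb2 : h <= h2 / 2) by (eapply Rle_trans; [apply Rmin_l|apply Rmin_r]).
assert (hb3 : h <= s0 - al) by (eapply Rle_trans; [apply Rmin_r|apply Rmin_l]).
assert (hb4 : h <= be - s0) by (eapply Rle_trans; [apply Rmin_r|apply Rmin_r]).
assert (hl : T (s0 - h) < T s0) by (apply hTi; lra).
assert (hr : T s0 < T (s0 + h)) by (apply hTi; lra).
set (del := Rmin (T s0 - T (s0 - h)) (T (s0 + h) - T s0)).
assert (hdel : 0 < del) by (apply Rmin_pos; lra).
exists (mkposreal del hdel); simpl.
intros y hy0 hy.
assert (hyb : T (s0 - h) <= T s0 + y <= T (s0 + h)).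
{ apply Rabs_def2 in hy.
  assert (del <= T s0 - T (s0 - h)) by apply Rmin_l.
  assert (del <= T (s0 + h) - T s0) by apply Rmin_r.
  lra. }
destruct (IVT_le T (s0 - h) (s0 + h) (T s0 + y)) as [s [hs e]].
- lra.
- intros z hz; apply hTc; lra.
- exact hyb.
- set (k := s - s0).
  assert (hk0 : k <> 0).
  { intros hk; apply hy0.
    replace s with s0 in e by (unfold k in hk; lra); lra. }
  assert (hk : Rabs k <= h) by (apply Rabs_le; unfold k; lra).
  assert (hy' : y = T (s0 + k) - T s0).
  { unfold k; replace (s0 + (s - s0)) with s by ring; lra. }
  rewrite <- e, hx, hx by lra.
  replace (g s) with (g (s0 + k)) by (unfold k; f_equal; ring).
  specialize (H1 k hk0 ltac:(lra)).
  specialize (H2 k hk0 ltac:(lra)).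
  set (p := (T (s0 + k) - T s0) / k) in *.
  set (q := (g (s0 + k) - g s0) / k) in *.
  assert (hp : c / 2 < p).
  { apply Rabs_def2 in H1.
    assert (e1 <= c / 2) by apply Rmin_l; lra. }
  (* The quotient of [x] is [q / p]; its error is expressed through the errors [q - d] and [p - c],
     both below [e1]. *)
  replace ((g (s0 + k) - g s0) / y - d / c)
    with (((q - d) - d / c * (p - c)) / p).
  2: { unfold q; rewrite hy'; unfold p; field.
       lra. }
  unfold Rdiv at 1; rewrite Rabs_mult, Rabs_inv, (Rabs_pos_eq p) by lra.
  assert (hnum : Rabs (q - d - d / c * (p - c)) <= e1 * M).
  { unfold M.
    eapply Rle_trans; [apply Rabs_triang|].
    rewrite Rabs_Ropp, Rabs_mult.
    assert (0 <= Rabs (d / c)) by apply Rabs_pos.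
    nra. }
  assert (he2 : e1 * M <= eps * c / 4).
  { assert (e1 <= eps * c / (4 * M)) by apply Rmin_r.
    replace (eps * c / 4) with (eps * c / (4 * M) * M) by (field; lra).
    apply Rmult_le_compat_r; lra. }
  apply (Rmult_lt_reg_r p); [lra|].
  rewrite Rmult_assoc, Rinv_l, Rmult_1_r by lra.
  nra.
Qed.

Lemma first_nonpos (f : R -> R) (a z : R) :
  a <= z -> (forall x, a <= x <= z -> continuity_pt f x) -> 0 < f a -> f z <= 0 ->
  exists t, a < t <= z /\ f t = 0 /\ forall y, a <= y < t -> 0 < f y.
Proof.
intros haz hc ha hz.
destruct (first_exit (fun x => 0 < f x) a z) as [t [ht [hl hr]]]; trivial; try lra.
assert (ht0 : f t <= 0).
{ apply Rnot_lt_le; intros hpos.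
  destruct (continuity_pt_pos f t (hc t ht) hpos) as [h [hh H]].
  destruct (hr h hh) as [y [hy [_ hn]]].
  apply hn, H, Rabs_def1; lra. }
assert (hat : a < t).
{ destruct (proj1 ht) as [h|<-]; [exact h|lra]. }
exists t; split; [lra|split; [|exact hl]].
apply Rle_antisym; [exact ht0|].
apply Rnot_lt_le; intros hneg.
destruct (continuity_pt_pos (fun x => - f x) t) as [h [hh H]].
- apply continuity_pt_opp, hc, ht.
- lra.
- set (y := Rmax a (t - h / 2)).
  assert (a <= y) by apply Rmax_l.
  assert (t - h / 2 <= y) by apply Rmax_r.
  assert (y < t) by (apply Rmax_lub_lt; lra).
  specialize (H y ltac:(apply Rabs_def1; lra)).
  specialize (hl y ltac:(lra)); lra.
Qed.

(** This is the exit from [0 <= f], not the first zero: [f] may touch 0 earlier without changing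
    sign. For a velocity, only an actual change of sign can give a turning point. *)
Lemma first_neg (f : R -> R) (a z : R) :
  a <= z -> (forall x, a <= x <= z -> continuity_pt f x) -> 0 < f a -> f z < 0 ->
  exists t, a < t < z /\ f t = 0 /\
            forall h, 0 < h -> exists s, t < s < t + h /\ f s < 0.
Proof.
intros haz hc ha hz.
destruct (first_exit (fun x => 0 <= f x) a z) as [t [ht [hl hr]]]; trivial; try lra.
assert (ht0 : f t <= 0).
{ apply Rnot_lt_le; intros hpos.
  destruct (continuity_pt_pos f t (hc t ht) hpos) as [h [hh H]].
  destruct (hr h hh) as [y [hy [_ hn]]].
  apply hn, Rlt_le, H, Rabs_def1; lra. }
assert (hat : a < t).
{ destruct (proj1 ht) as [h|<-]; [exact h|lra]. }
assert (ht1 : f t = 0).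
{ apply Rle_antisym; [exact ht0|].
  apply Rnot_lt_le; intros hneg.
  destruct (continuity_pt_pos (fun x => - f x) t) as [h [hh H]].
  - apply continuity_pt_opp, hc, ht.
  - lra.
  - set (y := Rmax a (t - h / 2)).
    assert (a <= y) by apply Rmax_l.
    assert (t - h / 2 <= y) by apply Rmax_r.
    assert (y < t) by (apply Rmax_lub_lt; lra).
    specialize (H y ltac:(apply Rabs_def1; lra)).
    specialize (hl y ltac:(lra)); lra. }
assert (htz : t < z).
{ destruct (proj2 ht) as [h| ->]; [exact h|lra]. }
exists t; split; [lra|split; [exact ht1|]].
intros h hh.
destruct (hr h hh) as [y [hy [_ hn]]].
exists y.
destruct (proj1 hy) as [h'|<-]; lra.
Qed.

(** * Uniqueness, reversibility and global existence *)

(** The partial derivatives of [Gamma]. Divisions are written as factors [/ d], so that the closure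
    lemmas for [lip_close] apply syntactically. *)
Definition Gamma_p1 (m q1 q2 p1 p2 : R) : R :=
  / 8 * q2 ^ 2 * p1 + / (8 * m) * (q2 ^ 2 * p1 - 2 * q1 * q2 * p2).
Definition Gamma_p2 (m q1 q2 p1 p2 : R) : R :=
  / (4 * m) * q1 * (2 * q1 * p2 - q2 * p1).
Definition Gamma_q1 (m q1 q2 p1 p2 : R) : R :=
  / (4 * m) * p2 * (2 * q1 * p2 - q2 * p1) - 2 * m ^ 2 * q1
  - 4 * m * q1 * q2 ^ 4 * (/ (q1 ^ 2 + q2 ^ 2)) ^ 2
  - 2 * q1 * q2 ^ 4 * (/ (2 * q1 ^ 2 + q2 ^ 2)) ^ 2 + 2 * q1 * q2 ^ 2.
Definition Gamma_q2 (m q1 q2 p1 p2 : R) : R :=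
  / 8 * q2 * p1 ^ 2 + / (8 * m) * p1 * (q2 * p1 - 2 * q1 * p2) - 4 * m * q2
  - 4 * m * q2 * q1 ^ 4 * (/ (q1 ^ 2 + q2 ^ 2)) ^ 2
  - 4 * q2 * q1 ^ 4 * (/ (2 * q1 ^ 2 + q2 ^ 2)) ^ 2 + 2 * q1 ^ 2 * q2.

Lemma phase_space_pos (q1 q2 : R) : in_phase_space q1 q2 -> 0 < q1 ^ 2 + q2 ^ 2.
Proof.
intros h.
destruct (Req_dec q1 0) as [->|h1]; [|nra].
assert (q2 <> 0) by (intros ->; now apply h).
nra.
Qed.

Lemma Derive_Gamma (m q1 q2 p1 p2 : R) : 0 < m -> in_phase_space q1 q2 ->
  Derive (fun p => Gamma m energy q1 q2 p p2) p1 = Gamma_p1 m q1 q2 p1 p2 /\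
  Derive (fun p => Gamma m energy q1 q2 p1 p) p2 = Gamma_p2 m q1 q2 p1 p2 /\
  Derive (fun q => Gamma m energy q q2 p1 p2) q1 = Gamma_q1 m q1 q2 p1 p2 /\
  Derive (fun q => Gamma m energy q1 q p1 p2) q2 = Gamma_q2 m q1 q2 p1 p2.
Proof.
intros hm h; apply phase_space_pos in h.
assert (h' : 0 < 2 * q1 ^ 2 + q2 ^ 2) by nra.
repeat split; apply is_derive_unique;
  unfold Gamma, Gamma_p1, Gamma_p2, Gamma_q1, Gamma_q2, energy;
  auto_derive; try (repeat split; lra); field; lra.
Qed.

Record flows (m : R) (Q1 Q2 P1 P2 : R -> R) (s : R) : Prop := Flows {
  flow_dom : in_phase_space (Q1 s) (Q2 s);
  flow_Q1 : is_derive Q1 s (Gamma_p1 m (Q1 s) (Q2 s) (P1 s) (P2 s));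
  flow_Q2 : is_derive Q2 s (Gamma_p2 m (Q1 s) (Q2 s) (P1 s) (P2 s));
  flow_P1 : is_derive P1 s (- Gamma_q1 m (Q1 s) (Q2 s) (P1 s) (P2 s));
  flow_P2 : is_derive P2 s (- Gamma_q2 m (Q1 s) (Q2 s) (P1 s) (P2 s)) }.

Lemma hamilton_solutionE (m : R) (a b : Rbar) (Q1 Q2 P1 P2 : R -> R) : 0 < m ->
  hamilton_solution m a b Q1 Q2 P1 P2 <->
  forall s, in_interval a b s -> flows m Q1 Q2 P1 P2 s.
Proof.
intros hm; split; intros H s hs; specialize (H s hs).
- destruct H as [hd H].
  destruct (Derive_Gamma m _ _ (P1 s) (P2 s) hm hd) as [e1 [e2 [e3 e4]]].
  rewrite e1, e2, e3, e4 in H.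
  now constructor.
- destruct H as [hd H1 H2 H3 H4].
  destruct (Derive_Gamma m _ _ (P1 s) (P2 s) hm hd) as [e1 [e2 [e3 e4]]].
  now rewrite e1, e2, e3, e4.
Qed.

(** The Hamiltonian field is built from the coordinates by ring operations and
    inverses bounded away from 0, so a Lipschitz bound along two given solutions
    follows from closure of this relation under those operations. *)
Definition lip_close (al be : R) (N f g : R -> R) : Prop :=
  exists B K, 0 <= B /\ 0 <= K /\ forall s, al <= s <= be ->
    Rabs (f s) <= B /\ Rabs (g s) <= B /\ Rabs (f s - g s) <= K * N s.

Section LipClose.
Variables (al be : R) (N : R -> R).
Hypothesis hab : al <= be.
Notation lipc := (lip_close al be N).

Lemma lip_close_const (c : R) : lipc (fun _ => c) (fun _ => c).
Proof.
exists (Rabs c), 0.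
split; [apply Rabs_pos|split; [lra|intros s hs]].
replace (c - c) with 0 by ring; rewrite Rabs_R0; lra.
Qed.

Lemma continuity_bounded (f : R -> R) :
  (forall s, al <= s <= be -> continuity_pt f s) ->
  exists B, 0 <= B /\ forall s, al <= s <= be -> Rabs (f s) <= B.
Proof.
intros hf.
destruct (continuity_ab_maj f al be hab hf) as [x [hx _]].
destruct (continuity_ab_min f al be hab hf) as [y [hy _]].
exists (Rabs (f x) + Rabs (f y)); split.
- generalize (Rabs_pos (f x)) (Rabs_pos (f y)); lra.
- intros s hs; specialize (hx s hs); specialize (hy s hs).
  apply Rabs_le.
  generalize (Rle_abs (f x)) (Rle_abs (- f y)) (Rabs_pos (f x)) (Rabs_pos (f y)).
  rewrite Rabs_Ropp; lra.
Qed.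

Lemma lip_close_base (f g : R -> R) :
  (forall s, al <= s <= be -> continuity_pt f s) ->
  (forall s, al <= s <= be -> continuity_pt g s) ->
  (forall s, Rabs (f s - g s) <= N s) -> lipc f g.
Proof.
intros hf hg h.
destruct (continuity_bounded f hf) as [B [hB hfB]].
destruct (continuity_bounded g hg) as [C [hC hgC]].
exists (B + C), 1.
split; [lra|split; [lra|intros s hs]].
specialize (hfB s hs); specialize (hgC s hs); specialize (h s); lra.
Qed.

Lemma lip_close_opp (f g : R -> R) : lipc f g -> lipc (fun s => - f s) (fun s => - g s).
Proof.
intros [B [K [hB [hK H]]]].
exists B, K.
split; [exact hB|split; [exact hK|intros s hs]].
replace (- f s - - g s) with (- (f s - g s)) by ring.
rewrite !Rabs_Ropp; auto.
Qed.

Lemma lip_close_plus (f g f' g' : R -> R) :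
  lipc f g -> lipc f' g' -> lipc (fun s => f s + f' s) (fun s => g s + g' s).
Proof.
intros [B [K [hB [hK H]]]] [C [L [hC [hL G]]]].
exists (B + C), (K + L).
split; [lra|split; [lra|intros s hs]].
destruct (H s hs) as [h1 [h2 h3]]; destruct (G s hs) as [g1 [g2 g3]].
replace (f s + f' s - (g s + g' s)) with ((f s - g s) + (f' s - g' s)) by ring.
repeat split; (eapply Rle_trans; [apply Rabs_triang|lra]).
Qed.

Lemma lip_close_minus (f g f' g' : R -> R) :
  lipc f g -> lipc f' g' -> lipc (fun s => f s - f' s) (fun s => g s - g' s).
Proof. intros h h'; exact (lip_close_plus _ _ _ _ h (lip_close_opp _ _ h')). Qed.

Lemma lip_close_mult (f g f' g' : R -> R) :
  lipc f g -> lipc f' g' -> lipc (fun s => f s * f' s) (fun s => g s * g' s).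
Proof.
intros [B [K [hB [hK H]]]] [C [L [hC [hL G]]]].
exists (B * C), (B * L + C * K).
split; [nra|split; [nra|intros s hs]].
destruct (H s hs) as [h1 [h2 h3]]; destruct (G s hs) as [g1 [g2 g3]].
split; [|split].
- rewrite Rabs_mult; apply Rmult_le_compat; trivial; apply Rabs_pos.
- rewrite Rabs_mult; apply Rmult_le_compat; trivial; apply Rabs_pos.
- replace (f s * f' s - g s * g' s)
    with (g s * (f' s - g' s) + f' s * (f s - g s)) by ring.
  eapply Rle_trans; [apply Rabs_triang|].
  rewrite !Rabs_mult, Rmult_plus_distr_r, !Rmult_assoc.
  apply Rplus_le_compat; apply Rmult_le_compat; trivial; apply Rabs_pos.
Qed.

Lemma lip_close_pow (f g : R -> R) (n : nat) :
  lipc f g -> lipc (fun s => f s ^ n) (fun s => g s ^ n).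
Proof.
intros h; induction n as [|n IH].
- exact (lip_close_const 1).
- exact (lip_close_mult _ _ _ _ h IH).
Qed.

Lemma lip_close_inv (f g : R -> R) (c : R) : 0 < c ->
  (forall s, al <= s <= be -> c <= f s) -> (forall s, al <= s <= be -> c <= g s) ->
  lipc f g -> lipc (fun s => / f s) (fun s => / g s).
Proof.
intros hc hf hg [B [K [hB [hK H]]]].
assert (hic : 0 < / c) by now apply Rinv_0_lt_compat.
assert (hi : forall x, c <= x -> Rabs (/ x) <= / c).
{ intros x hx; rewrite Rabs_pos_eq.
  - now apply Rinv_le_contravar.
  - apply Rlt_le, Rinv_0_lt_compat; lra. }
exists (/ c), (/ c * / c * K).
split; [lra|split; [apply Rmult_le_pos; nra|intros s hs]].
destruct (H s hs) as [_ [_ h3]].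
split; [auto|split; [auto|]].
specialize (hf s hs); specialize (hg s hs).
replace (/ f s - / g s) with (- (/ f s * / g s * (f s - g s))) by (field; lra).
rewrite Rabs_Ropp, !Rabs_mult, (Rmult_assoc (/ c * / c)).
apply Rmult_le_compat; trivial; try apply Rabs_pos.
- apply Rmult_le_pos; apply Rabs_pos.
- apply Rmult_le_compat; auto; apply Rabs_pos.
Qed.

End LipClose.

Ltac solve_lip_close :=
  first [ assumption | apply lip_close_const | apply lip_close_pow; solve_lip_close
        | apply lip_close_minus; solve_lip_close
        | apply lip_close_plus; solve_lip_close
        | apply lip_close_mult; solve_lip_close ].

(** Gronwall for the squared Euclidean distance [D] of the two solutions, which is differentiable.
    The Lipschitz bounds use the sum [N] of absolute differences, and [N ^ 2 <= 4 * D] links the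
    two. *)
Lemma flows_unique_compact (m al be s0 : R) (Q1 Q2 P1 P2 Q1' Q2' P1' P2' : R -> R) :
  0 < m -> al <= s0 <= be ->
  (forall s, al <= s <= be -> flows m Q1 Q2 P1 P2 s) ->
  (forall s, al <= s <= be -> flows m Q1' Q2' P1' P2' s) ->
  Q1' s0 = Q1 s0 -> Q2' s0 = Q2 s0 -> P1' s0 = P1 s0 -> P2' s0 = P2 s0 ->
  forall s, al <= s <= be ->
    Q1' s = Q1 s /\ Q2' s = Q2 s /\ P1' s = P1 s /\ P2' s = P2 s.
Proof.
intros hm h0 F F' e1 e2 e3 e4.
set (N := fun s => Rabs (Q1 s - Q1' s) + Rabs (Q2 s - Q2' s)
                   + Rabs (P1 s - P1' s) + Rabs (P2 s - P2' s)).
set (D := fun s => (Q1 s - Q1' s) ^ 2 + (Q2 s - Q2' s) ^ 2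
                   + (P1 s - P1' s) ^ 2 + (P2 s - P2' s) ^ 2).
assert (hab : al <= be) by lra.
assert (hN : forall s, 0 <= N s).
{ intros s; unfold N; repeat apply Rplus_le_le_0_compat; apply Rabs_pos. }
assert (hND : forall s, N s ^ 2 <= 4 * D s).
{ intros s; unfold N, D.
  rewrite <- (pow2_abs (Q1 s - Q1' s)), <- (pow2_abs (Q2 s - Q2' s)),
    <- (pow2_abs (P1 s - P1' s)), <- (pow2_abs (P2 s - P2' s)).
  generalize (Rabs (Q1 s - Q1' s)) (Rabs (Q2 s - Q2' s))
    (Rabs (P1 s - P1' s)) (Rabs (P2 s - P2' s)); intros x y z t.
  generalize (pow2_ge_0 (x - y)) (pow2_ge_0 (x - z)) (pow2_ge_0 (x - t))
    (pow2_ge_0 (y - z)) (pow2_ge_0 (y - t)) (pow2_ge_0 (z - t)); lra. }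
assert (B1 : lip_close al be N Q1 Q1').
{ apply lip_close_base; trivial.
  - intros s hs; eapply is_derive_continuity_pt, flow_Q1, F, hs.
  - intros s hs; eapply is_derive_continuity_pt, flow_Q1, F', hs.
  - intros s; unfold N.
    generalize (Rabs_pos (Q2 s - Q2' s)) (Rabs_pos (P1 s - P1' s))
      (Rabs_pos (P2 s - P2' s)); lra. }
assert (B2 : lip_close al be N Q2 Q2').
{ apply lip_close_base; trivial.
  - intros s hs; eapply is_derive_continuity_pt, flow_Q2, F, hs.
  - intros s hs; eapply is_derive_continuity_pt, flow_Q2, F', hs.
  - intros s; unfold N.
    generalize (Rabs_pos (Q1 s - Q1' s)) (Rabs_pos (P1 s - P1' s))
      (Rabs_pos (P2 s - P2' s)); lra. }
assert (B3 : lip_close al be N P1 P1').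
{ apply lip_close_base; trivial.
  - intros s hs; eapply is_derive_continuity_pt, flow_P1, F, hs.
  - intros s hs; eapply is_derive_continuity_pt, flow_P1, F', hs.
  - intros s; unfold N.
    generalize (Rabs_pos (Q1 s - Q1' s)) (Rabs_pos (Q2 s - Q2' s))
      (Rabs_pos (P2 s - P2' s)); lra. }
assert (B4 : lip_close al be N P2 P2').
{ apply lip_close_base; trivial.
  - intros s hs; eapply is_derive_continuity_pt, flow_P2, F, hs.
  - intros s hs; eapply is_derive_continuity_pt, flow_P2, F', hs.
  - intros s; unfold N.
    generalize (Rabs_pos (Q1 s - Q1' s)) (Rabs_pos (Q2 s - Q2' s))
      (Rabs_pos (P1 s - P1' s)); lra. }
(* Total collapse is outside the phase space, so on a compact interval the continuous function
   [X1 ^ 2 + X2 ^ 2] has a positive minimum. This bounds the denominators of the field away from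
   0. *)
assert (hden : forall X1 X2 Y1 Y2 : R -> R,
  (forall s, al <= s <= be -> flows m X1 X2 Y1 Y2 s) ->
  exists c, 0 < c /\ forall s, al <= s <= be -> c <= X1 s ^ 2 + X2 s ^ 2).
{ intros X1 X2 Y1 Y2 FX.
  destruct (continuity_ab_min (fun s => X1 s ^ 2 + X2 s ^ 2) al be hab)
    as [x [hx hx']].
  - intros s hs.
    assert (F1 := flow_Q1 _ _ _ _ _ _ (FX s hs)).
    assert (F2 := flow_Q2 _ _ _ _ _ _ (FX s hs)).
    eapply (is_derive_continuity_pt (fun s : R => X1 s ^ 2 + X2 s ^ 2)).
    auto_derive; [|reflexivity].
    repeat split; eexists; [exact F1|exact F2].
  - exists (X1 x ^ 2 + X2 x ^ 2); split; [|exact hx].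
    eapply phase_space_pos, flow_dom, FX, hx'. }
destruct (hden _ _ _ _ F) as [c [hc hcF]].
destruct (hden _ _ _ _ F') as [c' [hc' hcF']].
assert (hcc : 0 < Rmin c c') by now apply Rmin_pos.
assert (I1 : lip_close al be N (fun s => / (Q1 s ^ 2 + Q2 s ^ 2))
                               (fun s => / (Q1' s ^ 2 + Q2' s ^ 2))).
{ apply (lip_close_inv _ _ _ _ _ (Rmin c c')); trivial.
  - intros s hs; eapply Rle_trans; [apply Rmin_l|now apply hcF].
  - intros s hs; eapply Rle_trans; [apply Rmin_r|now apply hcF'].
  - apply lip_close_plus; now apply lip_close_pow. }
assert (I2 : lip_close al be N (fun s => / (2 * Q1 s ^ 2 + Q2 s ^ 2))
                               (fun s => / (2 * Q1' s ^ 2 + Q2' s ^ 2))).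
{ apply (lip_close_inv _ _ _ _ _ (Rmin c c')); trivial.
  - intros s hs; eapply Rle_trans; [apply Rmin_l|].
    specialize (hcF s hs); nra.
  - intros s hs; eapply Rle_trans; [apply Rmin_r|].
    specialize (hcF' s hs); nra.
  - apply lip_close_plus; [apply lip_close_mult; [apply lip_close_const|]|];
      trivial; now apply lip_close_pow. }
assert (L1 : lip_close al be N (fun s => Gamma_p1 m (Q1 s) (Q2 s) (P1 s) (P2 s))
  (fun s => Gamma_p1 m (Q1' s) (Q2' s) (P1' s) (P2' s))).
{ unfold Gamma_p1; solve_lip_close. }
assert (L2 : lip_close al be N (fun s => Gamma_p2 m (Q1 s) (Q2 s) (P1 s) (P2 s))
  (fun s => Gamma_p2 m (Q1' s) (Q2' s) (P1' s) (P2' s))).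
{ unfold Gamma_p2; solve_lip_close. }
assert (L3 : lip_close al be N (fun s => - Gamma_q1 m (Q1 s) (Q2 s) (P1 s) (P2 s))
  (fun s => - Gamma_q1 m (Q1' s) (Q2' s) (P1' s) (P2' s))).
{ unfold Gamma_q1; apply lip_close_opp; solve_lip_close. }
assert (L4 : lip_close al be N (fun s => - Gamma_q2 m (Q1 s) (Q2 s) (P1 s) (P2 s))
  (fun s => - Gamma_q2 m (Q1' s) (Q2' s) (P1' s) (P2' s))).
{ unfold Gamma_q2; apply lip_close_opp; solve_lip_close. }
destruct L1 as [C1 [K1 [_ [hK1 L1]]]], L2 as [C2 [K2 [_ [hK2 L2]]]],
  L3 as [C3 [K3 [_ [hK3 L3]]]], L4 as [C4 [K4 [_ [hK4 L4]]]].
set (dD := fun s =>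
  2 * (Q1 s - Q1' s) * (Gamma_p1 m (Q1 s) (Q2 s) (P1 s) (P2 s)
                        - Gamma_p1 m (Q1' s) (Q2' s) (P1' s) (P2' s))
  + 2 * (Q2 s - Q2' s) * (Gamma_p2 m (Q1 s) (Q2 s) (P1 s) (P2 s)
                        - Gamma_p2 m (Q1' s) (Q2' s) (P1' s) (P2' s))
  + 2 * (P1 s - P1' s) * (- Gamma_q1 m (Q1 s) (Q2 s) (P1 s) (P2 s)
                        - - Gamma_q1 m (Q1' s) (Q2' s) (P1' s) (P2' s))
  + 2 * (P2 s - P2' s) * (- Gamma_q2 m (Q1 s) (Q2 s) (P1 s) (P2 s)
                        - - Gamma_q2 m (Q1' s) (Q2' s) (P1' s) (P2' s))).
assert (hD : forall s, al <= s <= be -> D s = 0).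
(* Each of the four terms of [dD] is at most [2 * Ki * N ^ 2], and [N ^ 2 <= 4 * D] turns the factor
   2 into 8. *)
{ apply (gronwall_zero D dD (8 * (K1 + K2 + K3 + K4)) al be s0 h0).
  - intros s hs.
    destruct (F s hs) as [_ f1 f2 f3 f4], (F' s hs) as [_ g1 g2 g3 g4].
    unfold D, dD.
    auto_derive.
    + repeat split; eexists; eassumption.
    + rewrite (Derive_eta _ _ _ f1), (Derive_eta _ _ _ f2), (Derive_eta _ _ _ f3),
        (Derive_eta _ _ _ f4), (Derive_eta _ _ _ g1), (Derive_eta _ _ _ g2),
        (Derive_eta _ _ _ g3), (Derive_eta _ _ _ g4); ring.
  - intros s hs.
    split; [unfold D; repeat apply Rplus_le_le_0_compat; apply pow2_ge_0|].
    destruct (L1 s hs) as [_ [_ l1]], (L2 s hs) as [_ [_ l2]],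
      (L3 s hs) as [_ [_ l3]], (L4 s hs) as [_ [_ l4]].
    assert (hx : forall x y K, Rabs x <= N s -> Rabs y <= K * N s ->
      Rabs (2 * x * y) <= 2 * K * N s ^ 2).
    { intros x y K hx hy.
      rewrite !Rabs_mult, (Rabs_pos_eq 2) by lra.
      replace (2 * K * N s ^ 2) with (2 * N s * (K * N s)) by ring.
      apply Rmult_le_compat; trivial; try apply Rabs_pos.
      - apply Rmult_le_pos; [lra|apply Rabs_pos].
      - lra. }
    assert (n1 : Rabs (Q1 s - Q1' s) <= N s /\ Rabs (Q2 s - Q2' s) <= N s /\
                 Rabs (P1 s - P1' s) <= N s /\ Rabs (P2 s - P2' s) <= N s).
    { unfold N.
      generalize (Rabs_pos (Q1 s - Q1' s)) (Rabs_pos (Q2 s - Q2' s))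
        (Rabs_pos (P1 s - P1' s)) (Rabs_pos (P2 s - P2' s)); lra. }
    destruct n1 as [n1 [n2 [n3 n4]]].
    apply Rle_trans with (2 * (K1 + K2 + K3 + K4) * N s ^ 2).
    + replace (2 * (K1 + K2 + K3 + K4) * N s ^ 2)
        with (2 * K1 * N s ^ 2 + 2 * K2 * N s ^ 2 + 2 * K3 * N s ^ 2
              + 2 * K4 * N s ^ 2) by ring.
      unfold dD.
      do 3 (eapply Rle_trans; [apply Rabs_triang|]; apply Rplus_le_compat;
            [|now apply hx]).
      now apply hx.
    + specialize (hND s).
      replace (8 * (K1 + K2 + K3 + K4) * D s)
        with (2 * (K1 + K2 + K3 + K4) * (4 * D s)) by ring.
      apply Rmult_le_compat_l; lra.
  - unfold D; rewrite e1, e2, e3, e4; ring. }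
intros s hs; specialize (hD s hs); unfold D in hD.
generalize (pow2_ge_0 (Q1 s - Q1' s)) (pow2_ge_0 (Q2 s - Q2' s))
  (pow2_ge_0 (P1 s - P1' s)) (pow2_ge_0 (P2 s - P2' s)); intros.
assert (h2 : forall x y, (x - y) ^ 2 <= 0 -> y = x) by (intros x y h; nra).
repeat split; apply h2; lra.
Qed.

Lemma in_interval_convex (a b : Rbar) (s t u : R) :
  in_interval a b s -> in_interval a b t -> Rmin s t <= u <= Rmax s t ->
  in_interval a b u.
Proof.
unfold in_interval, Rmin, Rmax; intros hs ht hu.
destruct a, b, (Rle_dec s t); simpl in *; lra.
Qed.

Lemma locally_in_interval (a b : Rbar) (s : R) :
  in_interval a b s -> locally s (fun u : R => in_interval a b u).
Proof. exact (open_and _ _ (open_Rbar_gt a) (open_Rbar_lt b) s). Qed.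

Lemma flows_unique (m : R) (a b a' b' : Rbar) (s0 : R)
  (Q1 Q2 P1 P2 Q1' Q2' P1' P2' : R -> R) :
  0 < m -> in_interval a b s0 -> in_interval a' b' s0 ->
  (forall s, in_interval a b s -> flows m Q1 Q2 P1 P2 s) ->
  (forall s, in_interval a' b' s -> flows m Q1' Q2' P1' P2' s) ->
  Q1' s0 = Q1 s0 -> Q2' s0 = Q2 s0 -> P1' s0 = P1 s0 -> P2' s0 = P2 s0 ->
  forall s, in_interval a b s -> in_interval a' b' s ->
    Q1' s = Q1 s /\ Q2' s = Q2 s /\ P1' s = P1 s /\ P2' s = P2 s.
Proof.
intros hm h0 h0' F F' e1 e2 e3 e4 s hs hs'.
apply (flows_unique_compact m (Rmin s s0) (Rmax s s0) s0); auto.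
- split; [apply Rmin_r|apply Rmax_r].
- intros u hu; now apply F, (in_interval_convex a b s s0).
- intros u hu; now apply F', (in_interval_convex a' b' s s0).
- split; [apply Rmin_l|apply Rmax_l].
Qed.

(* [e = 1] is the reversal about a BC, [e = -1] the one about an SBC. *)
Lemma flows_reverse (m c e s : R) (Q1 Q2 P1 P2 : R -> R) : 0 < m ->
  e = 1 \/ e = -1 -> flows m Q1 Q2 P1 P2 (c - s) ->
  flows m (fun u => e * Q1 (c - u)) (fun u => - e * Q2 (c - u))
          (fun u => - e * P1 (c - u)) (fun u => e * P2 (c - u)) s.
Proof.
intros hm he [hd f1 f2 f3 f4].
assert (hpos := phase_space_pos _ _ hd).
assert (hpos' : 0 < 2 * Q1 (c - s) ^ 2 + Q2 (c - s) ^ 2) by nra.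
assert (hrev : forall (f : R -> R) (l k l' : R), is_derive f (c - s) l ->
  l' = - (k * l) -> is_derive (fun u => k * f (c - u)) s l').
{ intros f l k l' hf ->.
  auto_derive; [now exists l|].
  change (c + - s) with (c - s); rewrite (Derive_eta _ _ _ hf); ring. }
constructor.
- intros [z1 z2]; apply hd; split; destruct he as [-> | ->]; lra.
- apply (hrev _ _ _ _ f1).
  unfold Gamma_p1; destruct he as [-> | ->]; field; lra.
- apply (hrev _ _ _ _ f2).
  unfold Gamma_p2; destruct he as [-> | ->]; field; lra.
- apply (hrev _ _ _ _ f3).
  unfold Gamma_q1; destruct he as [-> | ->]; field; repeat split; nra.
- apply (hrev _ _ _ _ f4).
  unfold Gamma_q2; destruct he as [-> | ->]; field; repeat split; nra.
Qed.

(** * Gluing of solutions and maximality of the orbit *)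

Lemma flows_ext_loc (m s : R) (Q1 Q2 P1 P2 Q1' Q2' P1' P2' : R -> R) :
  locally s (fun u : R => Q1 u = Q1' u /\ Q2 u = Q2' u /\ P1 u = P1' u /\ P2 u = P2' u) ->
  flows m Q1 Q2 P1 P2 s -> flows m Q1' Q2' P1' P2' s.
Proof.
intros hloc [hd f1 f2 f3 f4].
destruct (locally_singleton _ _ hloc) as [e1 [e2 [e3 e4]]].
rewrite e1, e2, e3, e4 in *.
constructor; trivial; eapply is_derive_ext_loc; try eassumption;
  revert hloc; apply filter_imp; intros u hu; apply hu.
Qed.

Definition glue (a b : Rbar) (f g : R -> R) (s : R) : R :=
  if excluded_middle_informative (in_interval a b s) then f s else g s.

Lemma glue_in (a b : Rbar) (f g : R -> R) (s : R) :
  in_interval a b s -> glue a b f g s = f s.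
Proof. unfold glue; now destruct excluded_middle_informative. Qed.

Lemma glue_agree (a b : Rbar) (f g : R -> R) (s : R) :
  (in_interval a b s -> g s = f s) -> glue a b f g s = g s.
Proof.
unfold glue; destruct excluded_middle_informative; trivial.
intros h; symmetry; auto.
Qed.

(** By uniqueness the second solution agrees with the orbit on the common interval, so the two glue
    to a solution on the union. If that union were larger than [(a, b)], maximality would fail. *)
Lemma orbit_maximal (m R0 : R) (a b a' b' : Rbar) (s0 : R)
  (Q1 Q2 P1 P2 Q1' Q2' P1' P2' : R -> R) :
  0 < m -> orbit m R0 a b Q1 Q2 P1 P2 ->
  in_interval a b s0 -> in_interval a' b' s0 ->
  (forall s, in_interval a' b' s -> flows m Q1' Q2' P1' P2' s) ->
  Q1' s0 = Q1 s0 -> Q2' s0 = Q2 s0 -> P1' s0 = P1 s0 -> P2' s0 = P2 s0 ->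
  Rbar_le a a' /\ Rbar_le b' b.
Proof.
intros hm [_ [F [_ [_ [_ [_ hmax]]]]]] h0 h0' F' e1 e2 e3 e4.
rewrite hamilton_solutionE in F by exact hm.
assert (U := flows_unique m a b a' b' s0 _ _ _ _ _ _ _ _ hm h0 h0' F F' e1 e2 e3 e4).
(* [(a'', b'')] is the union of the two intervals; it is an interval because both contain [s0]. *)
set (a'' := if Rbar_lt_dec a' a then a' else a).
set (b'' := if Rbar_lt_dec b b' then b' else b).
destruct (hmax a'' b'' (glue a b Q1 Q1') (glue a b Q2 Q2') (glue a b P1 P1')
            (glue a b P2 P2')) as [ha hb].
- unfold a''; destruct (Rbar_lt_dec a' a) as [h|h]; [exact (Rbar_lt_le _ _ h)|apply Rbar_le_refl].
- unfold b''; destruct (Rbar_lt_dec b b') as [h|h]; [exact (Rbar_lt_le _ _ h)|apply Rbar_le_refl].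
- apply hamilton_solutionE; [exact hm|].
  intros s hs.
  assert (hor : in_interval a b s \/ in_interval a' b' s).
  { unfold in_interval, a'', b'' in *; clear - h0 h0' hs.
    destruct (Rbar_lt_dec a s) as [h1|h1], (Rbar_lt_dec s b) as [h2|h2]; [now left|..];
      right; destruct (Rbar_lt_dec a' a), (Rbar_lt_dec b b'), a, b, a', b';
      simpl in *; try tauto; lra. }
  destruct hor as [h|h].
  + apply (flows_ext_loc m s Q1 Q2 P1 P2); [|now apply F].
    generalize (locally_in_interval a b s h); apply filter_imp; intros u hu.
    now rewrite !glue_in.
  + apply (flows_ext_loc m s Q1' Q2' P1' P2'); [|now apply F'].
    generalize (locally_in_interval a' b' s h); apply filter_imp; intros u hu.
    rewrite !glue_agree; auto; intros hu'; now apply U.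
- intros s hs; now rewrite !glue_in.
- split.
  + rewrite <- ha; unfold a''.
    destruct (Rbar_lt_dec a' a) as [h|h]; [apply Rbar_le_refl|now apply Rbar_not_lt_le].
  + rewrite <- hb; unfold b''.
    destruct (Rbar_lt_dec b b') as [h|h]; [apply Rbar_le_refl|now apply Rbar_not_lt_le].
Qed.

Lemma in_interval_reverse (c s : R) (a b : Rbar) :
  in_interval (Rbar_minus c b) (Rbar_minus c a) s <-> in_interval a b (c - s).
Proof. unfold in_interval; destruct a, b; simpl; intuition lra. Qed.

Lemma orbit_symmetric (m R0 : R) (a b : Rbar) (Q1 Q2 P1 P2 : R -> R) (s1 : R) :
  0 < m -> orbit m R0 a b Q1 Q2 P1 P2 -> 0 < s1 -> in_interval a b s1 ->
  Q1 s1 = 0 -> P2 s1 = 0 ->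
  a = m_infty /\ b = p_infty /\
  (forall s, Q1 (- s) = Q1 s /\ Q2 (- s) = - Q2 s /\
             P1 (- s) = - P1 s /\ P2 (- s) = P2 s) /\
  (forall s, Q1 (2 * s1 - s) = - Q1 s /\ Q2 (2 * s1 - s) = Q2 s /\
             P1 (2 * s1 - s) = P1 s /\ P2 (2 * s1 - s) = - P2 s).
Proof.
intros hm horb hs1 hin hQ1 hP2.
assert (F := horb); destruct F as [h0 [F [_ [i2 [i3 _]]]]].
rewrite hamilton_solutionE in F by exact hm.
assert (G : forall c e s : R, e = 1 \/ e = -1 ->
  in_interval (Rbar_minus c b) (Rbar_minus c a) s ->
  flows m (fun u => e * Q1 (c - u)) (fun u => - e * Q2 (c - u))
          (fun u => - e * P1 (c - u)) (fun u => e * P2 (c - u)) s).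
{ intros c e s he hs; apply flows_reverse; auto.
  apply F, in_interval_reverse, hs. }
assert (h00 : in_interval (Rbar_minus 0 b) (Rbar_minus 0 a) 0).
{ apply in_interval_reverse; now rewrite Rminus_0_r. }
assert (hab : Rbar_le a (Rbar_minus 0 b) /\ Rbar_le (Rbar_minus 0 a) b).
{ apply (orbit_maximal m R0 a b _ _ 0 _ _ _ _ _ _ _ _ hm horb h0 h00
           (fun s => G 0 1 s (or_introl eq_refl)));
    cbv beta; rewrite Rminus_0_r; lra. }
assert (e1 : 2 * s1 - s1 = s1) by ring.
assert (h11 : in_interval (Rbar_minus (2 * s1) b) (Rbar_minus (2 * s1) a) s1).
{ apply in_interval_reverse; now rewrite e1. }
assert (hab1 : Rbar_le a (Rbar_minus (2 * s1) b) /\ Rbar_le (Rbar_minus (2 * s1) a) b).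
{ apply (orbit_maximal m R0 a b _ _ s1 _ _ _ _ _ _ _ _ hm horb hin h11
           (fun s => G (2 * s1) (-1) s (or_intror eq_refl)));
    cbv beta; rewrite e1; lra. }
(* The reflection about 0 makes both ends finite or both infinite. Finite ends would satisfy
   [a + b = 0] by this reflection and [a + b = 2 * s1] by the one about [s1]. *)
assert (hinf : a = m_infty /\ b = p_infty).
{ unfold in_interval in h0; clear - hab hab1 h0 hs1.
  destruct a, b; simpl in *; try tauto; lra. }
destruct hinf as [-> ->].
assert (hall : forall s : R, in_interval m_infty p_infty s) by now split.
split; [reflexivity|split; [reflexivity|split]]; intros s.
- destruct (flows_unique m m_infty p_infty m_infty p_infty 0 Q1 Q2 P1 P2 _ _ _ _ hm
    h0 h0 F (fun s hs => G 0 1 s (or_introl eq_refl) hs)) with (s := s) as [u1 [u2 [u3 u4]]];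
    trivial; rewrite ?Rminus_0_r; try lra.
  rewrite !Rminus_0_l in *; lra.
- destruct (flows_unique m m_infty p_infty m_infty p_infty s1 Q1 Q2 P1 P2 _ _ _ _ hm
    hin hin F (fun s hs => G (2 * s1) (-1) s (or_intror eq_refl) hs)) with (s := s)
    as [u1 [u2 [u3 u4]]]; trivial; rewrite ?e1; try lra.
Qed.

(** * Motion of the inner bodies before the first SBC *)

Lemma flows_continuity (m s : R) (Q1 Q2 P1 P2 : R -> R) :
  flows m Q1 Q2 P1 P2 s ->
  continuity_pt Q1 s /\ continuity_pt Q2 s /\ continuity_pt P1 s /\ continuity_pt P2 s.
Proof.
intros [_ f1 f2 f3 f4]; repeat split; eapply is_derive_continuity_pt; eassumption.
Qed.

Lemma Gamma_conserved (m : R) (a b : Rbar) (s0 s : R) (Q1 Q2 P1 P2 : R -> R) :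
  0 < m -> (forall s, in_interval a b s -> flows m Q1 Q2 P1 P2 s) ->
  in_interval a b s0 -> in_interval a b s ->
  Gamma m energy (Q1 s) (Q2 s) (P1 s) (P2 s)
  = Gamma m energy (Q1 s0) (Q2 s0) (P1 s0) (P2 s0).
Proof.
intros hm F h0 hs.
set (G := fun s => Gamma m energy (Q1 s) (Q2 s) (P1 s) (P2 s)).
assert (hG : forall u, in_interval a b u -> is_derive G u 0).
{ intros u hu.
  destruct (F u hu) as [hd f1 f2 f3 f4].
  assert (hp := phase_space_pos _ _ hd).
  assert (hp' : 0 < 2 * Q1 u ^ 2 + Q2 u ^ 2) by nra.
  unfold G, Gamma, energy.
  auto_derive.
  - repeat split; try lra; eexists; eassumption.
  - rewrite (Derive_eta _ _ _ f1), (Derive_eta _ _ _ f2), (Derive_eta _ _ _ f3),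
      (Derive_eta _ _ _ f4).
    unfold Gamma_p1, Gamma_p2, Gamma_q1, Gamma_q2.
    field; repeat split; lra. }
destruct (Rtotal_order s s0) as [h|[->|h]]; [|reflexivity|].
- destruct (MVT_is_derive G (fun _ => 0) s s0 h) as [c [e _]]; [|unfold G in e; lra].
  intros u hu; apply hG, (in_interval_convex a b s s0); trivial.
  rewrite Rmin_left, Rmax_right; lra.
- destruct (MVT_is_derive G (fun _ => 0) s0 s h) as [c [e _]]; [|unfold G in e; lra].
  intros u hu; apply hG, (in_interval_convex a b s0 s); trivial.
  rewrite Rmin_left, Rmax_right; lra.
Qed.

(* [m] times the physical velocity of the second body. *)
Definition inner_momentum (Q1 Q2 P1 P2 : R -> R) (s : R) : R :=
  P2 s / (2 * Q2 s) - P1 s / (4 * Q1 s).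
(** The Newtonian forces on the first and second body: [q1 ^ 2], [q2 ^ 2], [q1 ^ 2 + q2 ^ 2] and
    [2 * q1 ^ 2 + q2 ^ 2] are the distances [x1 - x2], [2 * x2], [x1 + x2] and [2 * x1]. *)
Definition outer_force (m q1 q2 : R) : R :=
  - (m / q1 ^ 4 + m / (q1 ^ 2 + q2 ^ 2) ^ 2 + / (2 * q1 ^ 2 + q2 ^ 2) ^ 2).
Definition inner_force (m q1 q2 : R) : R :=
  m / q1 ^ 4 - m / (q1 ^ 2 + q2 ^ 2) ^ 2 - m ^ 2 / q2 ^ 4.

(** Newton's law for the first body, with the factor [Q1 ^ 2 * Q2 ^ 2] from the change of time.
    [Gamma] is this factor times the energy excess, so differentiating the factor adds a multiple of
    [Gamma] itself; the law therefore holds on the level [Gamma = 0]. *)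
Lemma is_derive_outer_velocity (m s : R) (Q1 Q2 P1 P2 : R -> R) :
  0 < m -> flows m Q1 Q2 P1 P2 s -> Q1 s <> 0 ->
  Gamma m energy (Q1 s) (Q2 s) (P1 s) (P2 s) = 0 ->
  is_derive (fun u => P1 u / (4 * Q1 u)) s
    (Q1 s ^ 2 * Q2 s ^ 2 * outer_force m (Q1 s) (Q2 s)).
Proof.
intros hm [hd f1 f2 f3 f4] h1 hG.
assert (hp := phase_space_pos _ _ hd).
assert (hp' : 0 < 2 * Q1 s ^ 2 + Q2 s ^ 2) by nra.
auto_derive.
- repeat split; try lra; eexists; eassumption.
- rewrite (Derive_eta _ _ _ f1), (Derive_eta _ _ _ f3).
  apply Rminus_diag_uniq.
  transitivity (- / (2 * Q1 s ^ 2) * Gamma m energy (Q1 s) (Q2 s) (P1 s) (P2 s));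
    [|rewrite hG; ring].
  unfold Gamma, energy, Gamma_p1, Gamma_q1, outer_force.
  field; repeat split; lra.
Qed.

Lemma is_derive_inner_momentum (m s : R) (Q1 Q2 P1 P2 : R -> R) :
  0 < m -> flows m Q1 Q2 P1 P2 s -> Q1 s <> 0 -> Q2 s <> 0 ->
  Gamma m energy (Q1 s) (Q2 s) (P1 s) (P2 s) = 0 ->
  is_derive (inner_momentum Q1 Q2 P1 P2) s
    (Q1 s ^ 2 * Q2 s ^ 2 * inner_force m (Q1 s) (Q2 s)).
Proof.
intros hm [hd f1 f2 f3 f4] h1 h2 hG.
assert (hp := phase_space_pos _ _ hd).
assert (hp' : 0 < 2 * Q1 s ^ 2 + Q2 s ^ 2) by nra.
unfold inner_momentum; auto_derive.
- repeat split; try lra; eexists; eassumption.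
- rewrite (Derive_eta _ _ _ f1), (Derive_eta _ _ _ f2), (Derive_eta _ _ _ f3),
    (Derive_eta _ _ _ f4).
  apply Rminus_diag_uniq.
  (* The multiple of [Gamma] by which the regularized flow deviates from Newton's law for the second
     body. *)
  transitivity ((/ (2 * Q1 s ^ 2) - / (Q2 s ^ 2))
                * Gamma m energy (Q1 s) (Q2 s) (P1 s) (P2 s));
    [|rewrite hG; ring].
  unfold Gamma, energy, Gamma_p1, Gamma_p2, Gamma_q1, Gamma_q2, inner_force.
  field; repeat split; lra.
Qed.

(** [2 * Q1 * P2 - Q2 * P1] is [4 * Q1 * Q2] times the inner momentum. Where it vanishes the second
    body is at rest, so the force varies through [Q1] alone. The derivative is positive when
    [P1 < 0 < Q1]. *)
Lemma is_derive_inner_force (m s : R) (Q1 Q2 P1 P2 : R -> R) :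
  0 < m -> flows m Q1 Q2 P1 P2 s -> Q1 s <> 0 -> Q2 s <> 0 ->
  2 * Q1 s * P2 s - Q2 s * P1 s = 0 ->
  is_derive (fun u => inner_force m (Q1 u) (Q2 u)) s
    (m / 2 * Q2 s ^ 2 * Q1 s * (- P1 s)
     * (/ (Q1 s ^ 2) ^ 3 - / (Q1 s ^ 2 + Q2 s ^ 2) ^ 3)).
Proof.
intros hm [hd f1 f2 f3 f4] h1 h2 hW.
assert (hp := phase_space_pos _ _ hd).
assert (e1 : Gamma_p1 m (Q1 s) (Q2 s) (P1 s) (P2 s) = / 8 * Q2 s ^ 2 * P1 s).
{ unfold Gamma_p1.
  replace (Q2 s ^ 2 * P1 s - 2 * Q1 s * Q2 s * P2 s)
    with (- Q2 s * (2 * Q1 s * P2 s - Q2 s * P1 s)) by ring.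
  rewrite hW; ring. }
assert (e2 : Gamma_p2 m (Q1 s) (Q2 s) (P1 s) (P2 s) = 0).
{ unfold Gamma_p2; rewrite hW; ring. }
rewrite e1 in f1; rewrite e2 in f2.
unfold inner_force; auto_derive.
- assert (0 < Q1 s ^ 2) by now apply pow2_gt_0.
  assert (0 < Q2 s ^ 2) by now apply pow2_gt_0.
  assert (0 < Q1 s ^ 4) by (replace (Q1 s ^ 4) with ((Q1 s ^ 2) ^ 2) by ring; nra).
  assert (0 < Q2 s ^ 4) by (replace (Q2 s ^ 4) with ((Q2 s ^ 2) ^ 2) by ring; nra).
  assert (0 < (Q1 s ^ 2 + Q2 s ^ 2) ^ 2) by nra.
  simpl in *; repeat split; try lra; eexists; eassumption.
- rewrite (Derive_eta _ _ _ f1), (Derive_eta _ _ _ f2).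
  field; repeat split; lra.
Qed.

(** * Physical time and turning points of the second body *)

Lemma is_derive_phys_time (m : R) (a b : Rbar) (s : R) (Q1 Q2 P1 P2 : R -> R) :
  (forall s, in_interval a b s -> flows m Q1 Q2 P1 P2 s) ->
  in_interval a b 0 -> in_interval a b s ->
  is_derive (phys_time Q1 Q2) s (Q1 s ^ 2 * Q2 s ^ 2).
Proof.
intros F h0 hs.
assert (hc : forall u, in_interval a b u ->
  continuous (fun u : R => Q1 u ^ 2 * Q2 u ^ 2) u).
{ intros u hu; destruct (F u hu) as [_ f1 f2 _ _].
  apply (ex_derive_continuous (V := R_NormedModule)).
  auto_derive; repeat split; eexists; eassumption. }
apply (is_derive_RInt (fun u : R => Q1 u ^ 2 * Q2 u ^ 2) _ 0 s); [|now apply hc].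
generalize (locally_in_interval a b s hs); apply filter_imp; intros u hu.
apply (RInt_correct (V := R_CompleteNormedModule)), ex_RInt_continuous; intros z hz.
apply hc, (in_interval_convex a b 0 u); trivial.
Qed.

Lemma phys_time_le (m : R) (a b : Rbar) (s s' : R) (Q1 Q2 P1 P2 : R -> R) :
  (forall s, in_interval a b s -> flows m Q1 Q2 P1 P2 s) ->
  in_interval a b 0 -> in_interval a b s -> in_interval a b s' -> s <= s' ->
  phys_time Q1 Q2 s <= phys_time Q1 Q2 s'.
Proof.
intros F h0 hs hs' [h|<-]; [|lra].
destruct (MVT_is_derive (phys_time Q1 Q2) (fun u => Q1 u ^ 2 * Q2 u ^ 2) s s' h)
  as [c [e hc]].
- intros u hu; apply (is_derive_phys_time m a b u Q1 Q2 P1 P2); trivial.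
  apply (in_interval_convex a b s s'); trivial.
  rewrite Rmin_left, Rmax_right; lra.
- generalize (pow2_ge_0 (Q1 c * Q2 c)); intros hq.
  replace ((Q1 c * Q2 c) ^ 2) with (Q1 c ^ 2 * Q2 c ^ 2) in hq by ring.
  nra.
Qed.

(* Equal physical times force [Q1 * Q2 = 0] in between, and the derivative of
   [Q2 ^ 2] has the factor [Q1 * Q2]. *)
Lemma phys_time_determines_position (m : R) (a b : Rbar) (s s' : R)
  (Q1 Q2 P1 P2 : R -> R) :
  (forall s, in_interval a b s -> flows m Q1 Q2 P1 P2 s) ->
  in_interval a b 0 -> in_interval a b s -> in_interval a b s' -> s < s' ->
  phys_time Q1 Q2 s = phys_time Q1 Q2 s' -> Q2 s ^ 2 = Q2 s' ^ 2.
Proof.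
intros F h0 hs hs' h e.
assert (hin : forall u, s <= u <= s' -> in_interval a b u).
{ intros u hu; apply (in_interval_convex a b s s'); trivial.
  rewrite Rmin_left, Rmax_right; lra. }
destruct (MVT_is_derive (fun u => Q2 u ^ 2)
  (fun u => 2 * Q2 u * Gamma_p2 m (Q1 u) (Q2 u) (P1 u) (P2 u)) s s' h) as [c [e' hc]].
- intros u hu; destruct (F u (hin u hu)) as [_ _ f2 _ _].
  auto_derive; [now eexists; exact f2|].
  rewrite (Derive_eta _ _ _ f2); ring.
- assert (hz : Q1 c * Q2 c = 0).
  { apply NNPP; intros hn.
    assert (hpos : 0 < Q1 c ^ 2 * Q2 c ^ 2).
    { replace (Q1 c ^ 2 * Q2 c ^ 2) with (Rsqr (Q1 c * Q2 c)) by (unfold Rsqr; ring).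
      now apply Rsqr_pos_lt. }
    destruct (is_derive_pos_sign (phys_time Q1 Q2) c (Q1 c ^ 2 * Q2 c ^ 2)) as
      [k [hk [hr _]]]; trivial.
    { apply (is_derive_phys_time m a b c Q1 Q2 P1 P2); trivial; apply hin; lra. }
    set (y := Rmin (c + k / 2) s').
    assert (hy1 : y <= c + k / 2) by apply Rmin_l.
    assert (hy2 : y <= s') by apply Rmin_r.
    assert (hy3 : c < y) by (apply Rmin_glb_lt; lra).
    specialize (hr y ltac:(lra)).
    assert (h1 := phys_time_le m a b s c Q1 Q2 P1 P2 F h0 hs
                    (hin c ltac:(lra)) ltac:(lra)).
    assert (h2 := phys_time_le m a b y s' Q1 Q2 P1 P2 F h0
                    (hin y ltac:(lra)) hs' hy2).
    lra. }
  unfold Gamma_p2 in e'.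
  replace (2 * Q2 c * (/ (4 * m) * Q1 c * (2 * Q1 c * P2 c - Q2 c * P1 c)))
    with ((Q1 c * Q2 c) * (2 * / (4 * m) * (2 * Q1 c * P2 c - Q2 c * P1 c))) in e'
    by ring.
  rewrite hz in e'; lra.
Qed.

(** The threshold property speaks about a given position function, so one has to be produced. Choice
    selects some parameter with the given physical time; all such parameters give the same position.
    Values at times that are not attained are arbitrary. *)
Lemma second_body_position_exists (m : R) (a b : Rbar) (Q1 Q2 P1 P2 : R -> R) :
  (forall s, in_interval a b s -> flows m Q1 Q2 P1 P2 s) -> in_interval a b 0 ->
  exists x, second_body_position a b Q1 Q2 x.
Proof.
intros F h0.
exists (fun t => epsilon (inhabits 0) (fun y =>
  exists s, in_interval a b s /\ phys_time Q1 Q2 s = t /\ y = Q2 s ^ 2 / 2)).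
intros s hs.
set (P := fun y => _).
destruct (epsilon_spec (inhabits 0) P) as [s' [hs' [e ->]]].
- now exists (Q2 s ^ 2 / 2), s.
- enough (Q2 s ^ 2 = Q2 s' ^ 2) by lra.
  destruct (Rtotal_order s s') as [h|[->|h]]; [|reflexivity|symmetry];
    now apply (phys_time_determines_position m a b _ _ Q1 Q2 P1 P2).
Qed.

Lemma outer_force_neg (m q1 q2 : R) : 0 < m -> q1 <> 0 -> outer_force m q1 q2 < 0.
Proof.
intros hm h1; unfold outer_force.
assert (hq := pow2_gt_0 q1 h1).
assert (hq2 := pow2_ge_0 q2).
assert (0 < m / q1 ^ 4).
{ apply Rdiv_lt_0_compat; [exact hm|].
  replace (q1 ^ 4) with ((q1 ^ 2) ^ 2) by ring; now apply pow_lt. }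
assert (0 < m / (q1 ^ 2 + q2 ^ 2) ^ 2).
{ apply Rdiv_lt_0_compat; [exact hm|apply pow_lt; lra]. }
assert (0 < / (2 * q1 ^ 2 + q2 ^ 2) ^ 2).
{ apply Rinv_0_lt_compat, pow_lt; lra. }
lra.
Qed.

(* A zero of the inner velocity at which the force on the inner body also
   vanishes is not a change to negative velocity: the outer body moves inwards,
   so that the force increases and the velocity becomes positive again. *)
Lemma inner_force_neg_at_turn (m t z : R) (Q1 Q2 P1 P2 : R -> R) :
  0 < m -> 0 < t < z ->
  (forall s, 0 <= s <= z -> flows m Q1 Q2 P1 P2 s) ->
  (forall s, 0 <= s < z -> 0 < Q1 s) -> (forall s, 0 < s < z -> 0 < Q2 s) ->
  (forall s, 0 <= s <= z -> Gamma m energy (Q1 s) (Q2 s) (P1 s) (P2 s) = 0) ->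
  P1 0 = 0 ->
  inner_momentum Q1 Q2 P1 P2 t = 0 ->
  (forall h, 0 < h -> exists s, t < s < t + h /\ inner_momentum Q1 Q2 P1 P2 s < 0) ->
  inner_force m (Q1 t) (Q2 t) < 0.
Proof.
intros hm ht F hQ1 hQ2 hG hP1 hv hneg.
assert (hQ1t := hQ1 t ltac:(lra)).
assert (hQ2t := hQ2 t ltac:(lra)).
assert (hdv : forall s, 0 < s < z -> is_derive (inner_momentum Q1 Q2 P1 P2) s
    (Q1 s ^ 2 * Q2 s ^ 2 * inner_force m (Q1 s) (Q2 s))).
{ intros s hs.
  specialize (hQ1 s ltac:(lra)); specialize (hQ2 s hs).
  apply is_derive_inner_momentum; try apply F; try apply hG; lra. }
assert (hQQ : forall s, 0 < s < z -> 0 < Q1 s ^ 2 * Q2 s ^ 2).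
{ intros s hs.
  specialize (hQ1 s ltac:(lra)); specialize (hQ2 s hs).
  apply Rmult_lt_0_compat; apply pow_lt; lra. }
apply Rnot_le_lt; intros [hf|hf].
- destruct (is_derive_pos_sign _ _ _ (hdv t ht)) as [h [hh [hr _]]].
  + apply Rmult_lt_0_compat; auto.
  + destruct (hneg h hh) as [s [hs hn]].
    specialize (hr s hs); lra.
(* The case of zero force. The first body starts at rest and is pulled inwards throughout, so its
   velocity at [t] is negative. *)
- assert (hu : P1 t < 0).
  { destruct (MVT_is_derive (fun u => P1 u / (4 * Q1 u))
      (fun s => Q1 s ^ 2 * Q2 s ^ 2 * outer_force m (Q1 s) (Q2 s)) 0 t (proj1 ht))
      as [c [e hc]].
    - intros s hs; specialize (hQ1 s ltac:(lra)).
      apply (is_derive_outer_velocity m s Q1 Q2 P1 P2); try apply F; try apply hG; lra.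
    - rewrite hP1 in e.
      specialize (hQQ c ltac:(lra)).
      assert (hof := outer_force_neg m (Q1 c) (Q2 c) hm
        ltac:(specialize (hQ1 c ltac:(lra)); lra)).
      assert (h0 : P1 t / (4 * Q1 t) < 0).
      { replace (P1 t / (4 * Q1 t))
          with (P1 t / (4 * Q1 t) - 0 / (4 * Q1 0)) by (unfold Rdiv; ring).
        rewrite e.
        assert (0 < Q1 c ^ 2 * Q2 c ^ 2 * (- outer_force m (Q1 c) (Q2 c)) * (t - 0)).
        { apply Rmult_lt_0_compat; [apply Rmult_lt_0_compat; [exact hQQ|]|]; lra. }
        lra. }
      replace (P1 t) with (P1 t / (4 * Q1 t) * (4 * Q1 t)) by (field; lra).
      nra. }
  assert (hW : 2 * Q1 t * P2 t - Q2 t * P1 t = 0).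
  { transitivity (4 * Q1 t * Q2 t * inner_momentum Q1 Q2 P1 P2 t).
    - unfold inner_momentum; field; lra.
    - rewrite hv; ring. }
  destruct (is_derive_pos_sign (fun u => inner_force m (Q1 u) (Q2 u)) t _
    (is_derive_inner_force m t Q1 Q2 P1 P2 hm (F t ltac:(lra)) ltac:(lra) ltac:(lra) hW))
    as [h [hh [hr _]]].
  + assert (h1 : 0 < Q1 t ^ 2) by (apply pow_lt; lra).
    assert (h2 : 0 < Q2 t ^ 2) by (apply pow_lt; lra).
    apply Rmult_lt_0_compat.
    * repeat apply Rmult_lt_0_compat; lra.
    * apply Rlt_0_minus, Rinv_lt_contravar.
      -- apply Rmult_lt_0_compat; apply pow_lt; lra.
      -- generalize (Q1 t ^ 2) (Q2 t ^ 2) h1 h2; intros p q hp hq.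
         apply Rlt_0_minus.
         replace ((p + q) ^ 3 - p ^ 3) with (q * (3 * p * p + 3 * p * q + q * q)) by ring.
         apply Rmult_lt_0_compat; nra.
  (* The force is positive just after [t], so the momentum rises from 0 there, against the negative
     values supplied by [hneg]. *)
  + destruct (hneg (Rmin h (z - t)) ltac:(apply Rmin_pos; lra)) as [s [hs hn]].
    assert (Rmin h (z - t) <= h) by apply Rmin_l.
    assert (Rmin h (z - t) <= z - t) by apply Rmin_r.
    destruct (MVT_is_derive _ _ t s (proj1 hs)
      (fun u hu => hdv u ltac:(lra))) as [c [e hc]].
    rewrite hv in e.
    specialize (hr c ltac:(lra)); rewrite <- hf in hr.
    specialize (hQQ c ltac:(lra)).
    assert (0 < Q1 c ^ 2 * Q2 c ^ 2 * inner_force m (Q1 c) (Q2 c) * (s - t)).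
    { apply Rmult_lt_0_compat; [apply Rmult_lt_0_compat; [exact hQQ|exact hr]|lra]. }
    lra.
Qed.

Lemma is_derive_second_body (m z : R) (a b : Rbar) (Q1 Q2 P1 P2 x : R -> R) :
  0 < m -> (forall s, in_interval a b s -> flows m Q1 Q2 P1 P2 s) ->
  (forall s, 0 <= s <= z -> in_interval a b s) ->
  (forall s, 0 <= s < z -> 0 < Q1 s) -> (forall s, 0 < s < z -> 0 < Q2 s) ->
  second_body_position a b Q1 Q2 x ->
  forall s, 0 < s < z ->
    is_derive x (phys_time Q1 Q2 s) (inner_momentum Q1 Q2 P1 P2 s / m).
Proof.
intros hm F hin hQ1 hQ2 hx s hs.
assert (h0 : in_interval a b 0) by (apply hin; lra).
assert (hT : forall u, 0 <= u <= z ->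
  is_derive (phys_time Q1 Q2) u (Q1 u ^ 2 * Q2 u ^ 2)).
{ intros u hu; apply (is_derive_phys_time m a b u Q1 Q2 P1 P2); auto. }
assert (hQQ : forall s, 0 < s < z -> 0 < Q1 s ^ 2 * Q2 s ^ 2).
{ intros u hu.
  specialize (hQ1 u ltac:(lra)); specialize (hQ2 u hu).
  apply Rmult_lt_0_compat; apply pow_lt; lra. }
destruct (F s (hin s ltac:(lra))) as [_ _ f2 _ _].
assert (hg : is_derive (fun u => Q2 u ^ 2 / 2) s
               (Q2 s * Gamma_p2 m (Q1 s) (Q2 s) (P1 s) (P2 s))).
{ auto_derive; [now eexists; exact f2|].
  rewrite (Derive_eta _ _ _ f2); field. }
replace (inner_momentum Q1 Q2 P1 P2 s / m)
  with (Q2 s * Gamma_p2 m (Q1 s) (Q2 s) (P1 s) (P2 s) / (Q1 s ^ 2 * Q2 s ^ 2)).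
2: { specialize (hQ1 s ltac:(lra)); specialize (hQ2 s hs).
     unfold Gamma_p2, inner_momentum; field; lra. }
apply (is_derive_param x (phys_time Q1 Q2) (fun u => Q2 u ^ 2 / 2)
         (s / 2) ((s + z) / 2) s); auto.
- lra.
- intros u hu; eapply is_derive_continuity_pt, hT; lra.
- intros u u' hu hu' h.
  destruct (MVT_is_derive _ _ u u' h (fun v hv => hT v ltac:(lra))) as [c [e hc]].
  specialize (hQQ c ltac:(lra)); nra.
- intros u hu; apply hx, hin; lra.
- apply hT; lra.
Qed.

(** A negative force at a zero of the momentum makes the momentum positive just before and negative
    just after. Physical time is strictly increasing here, so the signs carry over to the velocity
    of [x]. *)
Lemma turning_point_phys_time (m t z : R) (a b : Rbar) (Q1 Q2 P1 P2 x : R -> R) :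
  0 < m -> (forall s, in_interval a b s -> flows m Q1 Q2 P1 P2 s) ->
  (forall s, 0 <= s <= z -> in_interval a b s) ->
  (forall s, 0 <= s < z -> 0 < Q1 s) -> (forall s, 0 < s < z -> 0 < Q2 s) ->
  (forall s, 0 <= s <= z -> Gamma m energy (Q1 s) (Q2 s) (P1 s) (P2 s) = 0) ->
  second_body_position a b Q1 Q2 x ->
  0 < t < z -> inner_momentum Q1 Q2 P1 P2 t = 0 -> inner_force m (Q1 t) (Q2 t) < 0 ->
  turning_point x (phys_time Q1 Q2 t).
Proof.
intros hm F hin hQ1 hQ2 hG hx ht hv hf.
assert (hdx := is_derive_second_body m z a b Q1 Q2 P1 P2 x hm F hin hQ1 hQ2 hx).
set (T := phys_time Q1 Q2) in *.
assert (hT : forall u, 0 <= u <= z -> is_derive T u (Q1 u ^ 2 * Q2 u ^ 2)).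
{ intros u hu; apply (is_derive_phys_time m a b u Q1 Q2 P1 P2); auto.
  apply hin; lra. }
assert (hQQ : forall s, 0 < s < z -> 0 < Q1 s ^ 2 * Q2 s ^ 2).
{ intros s hs.
  specialize (hQ1 s ltac:(lra)); specialize (hQ2 s hs).
  apply Rmult_lt_0_compat; apply pow_lt; lra. }
assert (hTlt : forall s s', 0 <= s -> s < s' -> s' <= z -> T s < T s').
{ intros s s' h1 h2 h3.
  destruct (MVT_is_derive _ _ s s' h2 (fun v hv => hT v ltac:(lra))) as [c [e hc]].
  specialize (hQQ c ltac:(lra)); nra. }
destruct (is_derive_pos_sign (fun s => - inner_momentum Q1 Q2 P1 P2 s) t
  (- (Q1 t ^ 2 * Q2 t ^ 2 * inner_force m (Q1 t) (Q2 t)))) as [h [hh [hr hl]]].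
- specialize (hQ1 t ltac:(lra)); specialize (hQ2 t ht).
  apply (is_derive_opp (V := R_NormedModule)), is_derive_inner_momentum; trivial;
    try lra; [apply F, hin|apply hG]; lra.
- specialize (hQQ t ht); nra.
- set (k := Rmin (h / 2) (Rmin (t / 2) ((z - t) / 2))).
  assert (hk : 0 < k) by (repeat apply Rmin_pos; lra).
  assert (hk1 : k <= h / 2) by apply Rmin_l.
  assert (hk2 : k <= t / 2) by (eapply Rle_trans; [apply Rmin_r|apply Rmin_l]).
  assert (hk3 : k <= (z - t) / 2) by (eapply Rle_trans; [apply Rmin_r|apply Rmin_r]).
  (* Every physical time in the window is attained at some parameter, where [hdx] gives the
     velocity. *)
  assert (hpre : forall s s' u, 0 < s -> s <= s' -> s' < z -> T s <= u <= T s' ->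
    exists r, s <= r <= s' /\ T r = u).
  { intros s s' u h1 h2 h3 hu; apply IVT_le; trivial.
    intros r hrr; eapply is_derive_continuity_pt, hT; lra. }
  split.
  { replace 0 with (inner_momentum Q1 Q2 P1 P2 t / m) by (rewrite hv; field; lra).
    now apply hdx. }
  exists (T (t - k)), (T (t + k)); split; [split; apply hTlt; lra|left; split].
  + intros u [hu1 hu2].
    destruct (hpre (t - k) t u) as [r [hrr <-]]; try lra.
    assert (r <> t) by (intros ->; lra).
    exists (inner_momentum Q1 Q2 P1 P2 r / m); split; [apply hdx; lra|].
    specialize (hl r ltac:(lra)).
    apply Rdiv_lt_0_compat; lra.
  + intros u [hu1 hu2].
    destruct (hpre t (t + k) u) as [r [hrr <-]]; try lra.
    assert (r <> t) by (intros ->; lra).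
    exists (inner_momentum Q1 Q2 P1 P2 r / m); split; [apply hdx; lra|].
    specialize (hr r ltac:(lra)).
    apply Rdiv_neg_pos; lra.
Qed.

(** * Signs of [Q1] and [Q2] up to the first SBC *)

Lemma Q1_pos_before_SBC (m R0 s1 : R) (a b : Rbar) (Q1 Q2 P1 P2 : R -> R) :
  0 < m -> 0 < R0 -> orbit m R0 a b Q1 Q2 P1 P2 -> first_SBC a b Q1 Q2 s1 ->
  forall s, 0 <= s < s1 -> 0 < Q1 s.
Proof.
intros hm hR [h0 [F [i1 _]]] [hs1 [hin1 [_ hfirst]]] s hs.
rewrite hamilton_solutionE in F by exact hm.
assert (hin : forall u, 0 <= u <= s -> in_interval a b u).
{ intros u hu; apply (in_interval_convex a b 0 s1); trivial.
  rewrite Rmin_left, Rmax_right; lra. }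
apply Rnot_le_lt; intros hn.
destruct (first_nonpos Q1 0 s) as [t [ht [e _]]]; try lra.
- intros u hu; now apply (flows_continuity m u Q1 Q2 P1 P2), F, hin.
(* A zero of [Q1] before [s1] would already be an SBC, since total collapse is outside the phase
   space. *)
- apply (hfirst t ltac:(lra)); split; [exact e|].
  intros e2; now apply (flow_dom _ _ _ _ _ _ (F t (hin t ltac:(lra)))).
Qed.

Lemma Q2_pos_before_SBC (m A0 R0 s1 : R) (a b : Rbar) (Q1 Q2 P1 P2 : R -> R) :
  0 < m -> turning_threshold m A0 -> 0 < R0 <= sqrt A0 ->
  orbit m R0 a b Q1 Q2 P1 P2 -> first_SBC a b Q1 Q2 s1 ->
  forall s, 0 < s <= s1 -> 0 < Q2 s.
Proof.
intros hm [hA0 hthr] hR horb hfirst z0 hz0.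
assert (hQ1 := Q1_pos_before_SBC m R0 s1 a b Q1 Q2 P1 P2 hm (proj1 hR) horb hfirst).
assert (horb' := horb); destruct horb' as [h0 [F [i1 [i2 [i3 [i4 _]]]]]].
assert (hfirst' := hfirst); destruct hfirst' as [hs1 [hin1 [[_ hQ2s1] _]]].
rewrite hamilton_solutionE in F by exact hm.
assert (hin : forall u, 0 <= u <= s1 -> in_interval a b u).
{ intros u hu; apply (in_interval_convex a b 0 s1); trivial.
  rewrite Rmin_left, Rmax_right; lra. }
assert (hP20 : 0 < P2 0).
{ rewrite i4; generalize (sqrt_lt_R0 m hm); nra. }
assert (hG : forall s, 0 <= s <= s1 ->
  Gamma m energy (Q1 s) (Q2 s) (P1 s) (P2 s) = 0).
{ intros s hs.
  rewrite (Gamma_conserved m a b 0 s Q1 Q2 P1 P2); auto.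
  rewrite i1, i2, i3, i4; unfold Gamma, energy.
  assert (e := sqrt_sqrt m ltac:(lra)).
  replace (4 * R0 ^ 2 * (2 * (m * sqrt m)) ^ 2)
    with (16 * R0 ^ 2 * m ^ 2 * (sqrt m * sqrt m)) by ring.
  rewrite e; field; nra. }
assert (hm4 : 0 < / (4 * m)) by (apply Rinv_0_lt_compat; lra).
apply Rnot_le_lt; intros hneg.
(* [Q2] vanishes at 0 with positive derivative. The search for its next zero [z] therefore starts at
   some [al > 0] where [Q2] is already positive. *)
destruct (is_derive_pos_sign Q2 0 _ (flow_Q2 _ _ _ _ _ _ (F 0 h0))) as [h [hh [hr _]]].
{ unfold Gamma_p2; rewrite i2, i3, i1.
  repeat apply Rmult_lt_0_compat; try lra.
  assert (0 < R0 * P2 0) by (apply Rmult_lt_0_compat; lra); lra. }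
rewrite i2 in hr.
set (al := Rmin (h / 2) (z0 / 2)).
assert (hal : 0 < al) by (apply Rmin_pos; lra).
assert (hal1 : al <= h / 2) by apply Rmin_l.
assert (hal2 : al <= z0 / 2) by apply Rmin_r.
destruct (first_nonpos Q2 al z0) as [z [hz [hQ2z hpos]]]; try lra.
{ intros u hu; apply (flows_continuity m u Q1 Q2 P1 P2), F, hin; lra. }
{ apply hr; lra. }
assert (hzs1 : z < s1).
{ destruct (Rle_lt_or_eq_dec z s1 ltac:(lra)) as [q|q]; [exact q|].
  now rewrite q in hQ2z. }
assert (hQ2 : forall s, 0 < s < z -> 0 < Q2 s).
{ intros s hs; destruct (Rlt_le_dec s al); [apply hr; lra|apply hpos; lra]. }
assert (hQ1z := hQ1 z ltac:(lra)).
(* At [Q2 = 0] the relation [Gamma = 0] excludes [P2 = 0], and [P2 z > 0] would make [Q2] increase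
   through 0 at [z], hence negative just before. *)
assert (hP2z : P2 z < 0).
{ destruct (Rtotal_order (P2 z) 0) as [q|[q|q]]; [exact q| |]; exfalso.
  - assert (e := hG z ltac:(lra)).
    rewrite hQ2z, q in e; unfold Gamma, energy in e.
    assert (0 < m ^ 2 * Q1 z ^ 2) by (apply Rmult_lt_0_compat; apply pow_lt; lra).
    unfold Rdiv in e; ring_simplify in e; lra.
  - destruct (is_derive_pos_sign Q2 z _ (flow_Q2 _ _ _ _ _ _ (F z (hin z ltac:(lra)))))
      as [k [hk [_ hl]]].
    + unfold Gamma_p2; rewrite hQ2z.
      repeat apply Rmult_lt_0_compat; try lra.
      assert (0 < Q1 z * P2 z) by (apply Rmult_lt_0_compat; lra); lra.
    + set (y := Rmax al (z - k / 2)).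
      assert (al <= y) by apply Rmax_l.
      assert (z - k / 2 <= y) by apply Rmax_r.
      assert (y < z) by (apply Rmax_lub_lt; lra).
      specialize (hl y ltac:(lra)); specialize (hQ2 y ltac:(lra)); lra. }
(* This expression has the sign of the inner velocity on [(0, z)] but involves no division, so it
   also makes sense at the collisions 0 and [z], where its signs are opposite. *)
destruct (first_neg (fun s => 2 * Q1 s * P2 s - Q2 s * P1 s) 0 z)
  as [t [ht [hWt hWneg]]].
- lra.
- intros s hs; destruct (F s (hin s ltac:(lra))) as [_ f1 f2 f3 f4].
  apply (is_derive_continuity_pt (fun s : R => 2 * Q1 s * P2 s - Q2 s * P1 s) s
    (Derive (fun s => 2 * Q1 s * P2 s - Q2 s * P1 s) s)), Derive_correct.
  auto_derive; repeat split; eexists; eassumption.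
- rewrite i1, i2, i3.
  assert (0 < R0 * P2 0) by (apply Rmult_lt_0_compat; lra); lra.
- rewrite hQ2z; nra.
- assert (hmom : forall s, 0 < s < z -> inner_momentum Q1 Q2 P1 P2 s
    = (2 * Q1 s * P2 s - Q2 s * P1 s) * / (4 * (Q1 s * Q2 s))).
  { intros s hs; specialize (hQ1 s ltac:(lra)); specialize (hQ2 s hs).
    unfold inner_momentum; field; lra. }
  assert (hvt : inner_momentum Q1 Q2 P1 P2 t = 0) by (rewrite hmom, hWt by lra; ring).
  assert (hf : inner_force m (Q1 t) (Q2 t) < 0).
  { apply (inner_force_neg_at_turn m t z Q1 Q2 P1 P2); trivial.
    - intros s hs; apply F, hin; lra.
    - intros s hs; apply hQ1; lra.
    - intros s hs; apply hG; lra.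
    - intros k hk.
      destruct (hWneg (Rmin k (z - t)) ltac:(apply Rmin_pos; lra)) as [s [hs hn]].
      assert (Rmin k (z - t) <= k) by apply Rmin_l.
      assert (Rmin k (z - t) <= z - t) by apply Rmin_r.
      exists s; split; [lra|].
      rewrite hmom by lra.
      assert (0 < / (4 * (Q1 s * Q2 s))); [|nra].
      specialize (hQ1 s ltac:(lra)); specialize (hQ2 s ltac:(lra)).
      apply Rinv_0_lt_compat; nra. }
  destruct (second_body_position_exists m a b Q1 Q2 P1 P2 F h0) as [x hx].
  (* The threshold bounds the position [A], and the orbit starts with [Q1 0 = sqrt A], hence
     [A = R0 ^ 2]. *)
  destruct (hthr (R0 ^ 2) a b Q1 Q2 P1 P2 s1 x) as [hno _]; trivial.
  { apply pow_lt; lra. }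
  { rewrite sqrt_pow2 by lra; exact horb. }
  apply hno.
  { rewrite <- (sqrt_sqrt A0) by lra; nra. }
  exists (phys_time Q1 Q2 t); split.
  + split.
    * destruct (MVT_is_derive (phys_time Q1 Q2) (fun u => Q1 u ^ 2 * Q2 u ^ 2) 0 t)
        as [c [e hc]]; [lra| |].
      { intros u hu; apply (is_derive_phys_time m a b u Q1 Q2 P1 P2); auto.
        apply hin; lra. }
      assert (e0 : phys_time Q1 Q2 0 = 0) by exact (RInt_point 0 _).
      rewrite e0 in e.
      assert (0 < Q1 c ^ 2 * Q2 c ^ 2).
      { specialize (hQ1 c ltac:(lra)); specialize (hQ2 c ltac:(lra)).
        apply Rmult_lt_0_compat; apply pow_lt; lra. }
      nra.
    * apply (phys_time_le m a b t s1 Q1 Q2 P1 P2); trivial; [apply hin|]; lra.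
  + apply (turning_point_phys_time m t z a b Q1 Q2 P1 P2 x); trivial.
    * intros s hs; apply hin; lra.
    * intros s hs; apply hQ1; lra.
    * intros s hs; apply hG; lra.
Qed.

(** * Periodicity *)

Lemma antiperiodic_zero (f : R -> R) (p : R) (k : Z) (s : R) :
  (forall s, f (s + p) = - f s) -> (f (s + IZR k * p) = 0 <-> f s = 0).
Proof.
intros hf.
induction k as [|k IH|k IH] using Z.peano_ind.
- now rewrite Rmult_0_l, Rplus_0_r.
- rewrite <- IH, succ_IZR.
  replace (s + (IZR k + 1) * p) with (s + IZR k * p + p) by ring.
  rewrite hf; lra.
- rewrite <- IH.
  replace (s + IZR k * p) with (s + IZR (Z.pred k) * p + p)
    by (unfold Z.pred; rewrite plus_IZR; ring).
  rewrite hf; lra.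
Qed.

(** The remainder is centred at 0, the centre of the first reversal, so that parity in [s] reduces
    the zeros of [Q1] and [Q2] to [[0, p]]. *)
Lemma reduce_mod (p s : R) : 0 < p ->
  exists (k : Z) (r : R), s = r + IZR k * (2 * p) /\ - p <= r < p.
Proof.
intros hp.
set (x := (s - p) / (2 * p)).
destruct (archimed x) as [h1 h2].
assert (e : s - p = x * (2 * p)) by (unfold x; field; lra).
exists (up x), (s - IZR (up x) * (2 * p)); split; [ring|nra].
Qed.

Theorem theorem4 (m A0 R0 : R) (a b : Rbar) (Q1 Q2 P1 P2 : R -> R) (s1 : R)
  (hm : 0 < m)
  (hA0 : turning_threshold m A0)
  (hR0 : 0 < R0 <= sqrt A0)
  (horb : orbit m R0 a b Q1 Q2 P1 P2)
  (hs1 : first_SBC a b Q1 Q2 s1)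
  (hP2 : P2 s1 = 0) :
  schubart_like a b Q1 Q2 P1 P2.
Proof.
assert (hQ1 := Q1_pos_before_SBC m R0 s1 a b Q1 Q2 P1 P2 hm (proj1 hR0) horb hs1).
assert (hQ2 := Q2_pos_before_SBC m A0 R0 s1 a b Q1 Q2 P1 P2 hm hA0 hR0 horb hs1).
destruct hs1 as [hpos [hin [[hQ1s1 _] _]]].
destruct (orbit_symmetric m R0 a b Q1 Q2 P1 P2 s1 hm horb hpos hin hQ1s1 hP2)
  as [-> [-> [hS0 hS1]]].
assert (hdom : forall s, in_phase_space (Q1 s) (Q2 s)).
{ intros s; destruct horb as [_ [F _]]; now apply F. }
assert (hQ20 : Q2 0 = 0) by apply horb.
assert (hanti : forall s, Q1 (s + 2 * s1) = - Q1 s /\ Q2 (s + 2 * s1) = - Q2 s /\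
                          P1 (s + 2 * s1) = - P1 s /\ P2 (s + 2 * s1) = - P2 s).
{ intros s; specialize (hS1 (- s)); specialize (hS0 s).
  replace (2 * s1 - - s) with (s + 2 * s1) in hS1 by ring; lra. }
assert (hz1 : forall k s, Q1 (s + IZR k * (2 * s1)) = 0 <-> Q1 s = 0).
{ intros k s; apply antiperiodic_zero; intros u; apply hanti. }
assert (hz2 : forall k s, Q2 (s + IZR k * (2 * s1)) = 0 <-> Q2 s = 0).
{ intros k s; apply antiperiodic_zero; intros u; apply hanti. }
split; [reflexivity|split; [reflexivity|split]].
- exists (4 * s1); split; [lra|]; intros s.
  replace (s + 4 * s1) with (s + 2 * s1 + 2 * s1) by ring.
  generalize (hanti (s + 2 * s1)) (hanti s); lra.
- exists 0, s1; split; [exact hpos|]; intros s.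
  split; split.
  + intros [e _].
    destruct (reduce_mod s1 s hpos) as [k [r [-> hr]]].
    rewrite hz2 in e.
    (* [Q2] is odd and positive on [(0, s1]], so its only zero in [[-s1, s1)] is 0. *)
    assert (r = 0).
    { destruct (Rtotal_order r 0) as [h|[h|h]]; [|exact h|].
      - specialize (hQ2 (- r) ltac:(lra)); specialize (hS0 r); lra.
      - specialize (hQ2 r ltac:(lra)); lra. }
    exists k; rewrite mult_IZR; subst r; ring.
  + intros [k ->].
    assert (e : Q2 (0 + IZR (2 * k) * s1) = 0).
    { rewrite mult_IZR.
      replace (0 + 2 * IZR k * s1) with (0 + IZR k * (2 * s1)) by ring.
      now apply hz2. }
    split; [exact e|]; intros e'; now apply (hdom (0 + IZR (2 * k) * s1)).
  + intros [e _].
    destruct (reduce_mod s1 s hpos) as [k [r [-> hr]]].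
    rewrite hz1 in e.
    (* [Q1] is even and positive on [[0, s1)]. The range of [r] contains [- s1] but not [s1], so the
       index of the SBC is [k - 1]: [- s1 + 2 * k * s1] is [(2 * (k - 1) + 1) * s1]. *)
    assert (r = - s1).
    { destruct (Rle_lt_or_eq_dec _ _ (proj1 hr)) as [h|h]; [|now symmetry].
      destruct (Rlt_le_dec r 0) as [h'|h'].
      - specialize (hQ1 (- r) ltac:(lra)); specialize (hS0 r); lra.
      - specialize (hQ1 r ltac:(lra)); lra. }
    exists (k - 1)%Z; rewrite plus_IZR, mult_IZR, minus_IZR; subst r; ring.
  + intros [k ->].
    assert (e : Q1 (0 + IZR (2 * k + 1) * s1) = 0).
    { rewrite plus_IZR, mult_IZR.
      replace (0 + (2 * IZR k + 1) * s1) with (s1 + IZR k * (2 * s1)) by ring.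
      now apply hz1. }
    split; [exact e|]; intros e'; now apply (hdom (0 + IZR (2 * k + 1) * s1)).
Qed.
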